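(* Let $\sigma$ and the deterministic data matrices $\mathbf X=\mathbf X_n\in\mathbb R^{d\times n}$ satisfy the assumptions listed in the context, and let $n_0$ be the smallest integer such that for all $n\ge n_0$, $$\max_{i\ne j}|\mathbf x_i^\top\mathbf x_j|\le \frac1{\sqrt2}\qquad\text{and}\qquad \left\|(\mathbf X^\top\mathbf X)^{\odot(\ell+1)}-\mathrm{Id}\right\|_F\le\frac{\sigma_{>\ell}^2}{4\|\sigma\|_4^2}.$$ Then for all $n\ge n_0$, $$\lambda_{\min}(\mathbf K)\ge\lambda_0:=\tfrac12\sigma_{>\ell}^2$$ and $$\|\mathbf K_\ell-\mathbf K\|\le\sqrt2\,\|\sigma\|_4^2\left\|(\mathbf X^\top\mathbf X)^{\odot(\ell+1)}-\mathrm{Id}\right\|_F\le\frac{\sigma_{>\ell}^2}{2\sqrt2}.$$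
   Context: $\|\cdot\|$ is the spectral norm, $\|\cdot\|_F$ the Frobenius norm, $A^{\odot k}$ the entrywise (Hadamard) $k$-th power, $\mathbb N=\{0,1,2,\dots\}$. Activation: $\sigma:\mathbb R\to\mathbb R$ satisfies $|\sigma(x)|\le C_\sigma(1+|x|)^{C_\sigma}$ for all $x$, for a constant $C_\sigma\ge0$. With $\xi\sim\mathcal N(0,1)$, $\|\sigma\|_2=(\mathbb E[\sigma^2(\xi)])^{1/2}$, $\|\sigma\|_4=(\mathbb E[\sigma^4(\xi)])^{1/4}$. The normalized Hermite polynomials are $h_k(x)=\frac{1}{\sqrt{k!}}(-1)^ke^{x^2/2}\frac{d^k}{dx^k}e^{-x^2/2}$, and $\zeta_k(\sigma)=\mathbb E[\sigma(\xi)h_k(\xi)]$. Data: for each $n$, $\mathbf X=[\mathbf x_1,\dots,\mathbf x_n]\in\mathbb R^{d\times n}$ (with $d=d_n$ growing with $n$) is deterministic with $\|\mathbf x_i\|=1$ for all $i$. $\ell\in\mathbb N$ is the smallest integer such that $\lim_{n\to\infty}\|(\mathbf X^\top\mathbf X)^{\odot(\ell+1)}-\mathrm{Id}\|_F=0$, and $\sigma_{>\ell}^2:=\|\sigma\|_2^2-\sum_{k=0}^\ell\zeta_k^2(\sigma)$ is assumed to be $>0$. Kernels: $\mathbf K\in\mathbb R^{n\times n}$ has entries $\mathbf K_{ij}=\mathbb E_{\mathbf w}[\sigma(\langle\mathbf w,\mathbf x_i\rangle)\sigma(\langle\mathbf w,\mathbf x_j\rangle)]$ with $\mathbf w\sim\mathcal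 N(0,\mathrm{Id}_d)$, and $\mathbf K_\ell:=\sum_{k=0}^\ell\zeta_k^2(\sigma)(\mathbf X^\top\mathbf X)^{\odot k}+\sigma_{>\ell}^2\mathrm{Id}$. *)

(* Defs.v *)
From HB Require Import structures.
From mathcomp Require Import all_boot all_order all_algebra.
From mathcomp Require Import all_classical all_reals all_analysis.

Set Implicit Arguments.
Unset Strict Implicit.
Unset Printing Implicit Defensive.

Import Order.TTheory GRing.Theory Num.Theory.
Import numFieldNormedType.Exports.

Local Open Scope classical_set_scope.
Local Open Scope ring_scope.

Section matrices.
Context {R : realType}.

Definition l2norm n (v : 'cV[R]_n) : R := Num.sqrt (\sum_i v i 0 ^+ 2).

Definition frobenius_norm m n (A : 'M[R]_(m, n)) : R :=
  Num.sqrt (\sum_i \sum_j A i j ^+ 2).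

(* The unit ball, rather than the unit sphere, keeps the set nonempty when
   n = 0 *)
Definition spectral_norm m n (A : 'M[R]_(m, n)) : R :=
  sup [set l2norm (A *m v) | v in [set v : 'cV[R]_n | l2norm v <= 1]].

(* Meaningful for symmetric A of size n > 0: its spectrum is then real, finite
   and nonempty.  For n = 0 the infimum is over the empty set. *)
Definition lambda_min n (A : 'M[R]_n) : R := inf [set a | eigenvalue A a].

Definition hadamard_pow k m n (A : 'M[R]_(m, n)) : 'M[R]_(m, n) :=
  map_mx (fun a => a ^+ k) A.

Definition gram d n (X : 'M[R]_(d, n)) : 'M[R]_n := X^T *m X.

(* The default value 0 only matters when n <= 1, where the range is empty *)
Definition max_offdiag n (A : 'M[R]_n) : R :=
  \big[Num.max/0]_(p : 'I_n * 'I_n | p.1 != p.2) `|A p.1 p.2|.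

Definition gram_pow_error l d n (X : 'M[R]_(d, n)) : R :=
  frobenius_norm (hadamard_pow l.+1 (gram X) - 1%:M).

End matrices.

Definition is_smallest (P : nat -> Prop) (m : nat) : Prop :=
  P m /\ forall k, P k -> (m <= k)%N.

Section gaussian_vector.
Context {R : realType}.
Local Notation M := (measurableTypeR R).

Definition tuple_cons d (p : M * d.-tuple M) : d.+1.-tuple M :=
  [tuple of p.1 :: p.2].

Lemma measurable_tuple_cons d :
  measurable_fun [set: M * d.-tuple M] (@tuple_cons d).
Proof. exact: measurable_cons measurable_fst measurable_snd. Qed.

HB.instance Definition _ d :=
  isMeasurableFun.Build _ _ _ _ (@tuple_cons d) (@measurable_tuple_cons d).

(* The law N(0, Id_d) on R^d: the d-fold product of N(0, 1), a (d+1)-tuple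
   being a head paired with a d-tuple *)
Fixpoint std_gaussian d : probability (d.-tuple M) R :=
  match d with
  | 0%N => dirac ([tuple] : 0.-tuple M)
  | d'.+1 => distribution (normal_prob (0 : R) 1 \x std_gaussian d')%E
               (@tuple_cons d')
  end.

Lemma std_gaussian_box d (A : 'I_d -> set M) :
  (forall k, measurable (A k)) ->
  std_gaussian d [set w | forall k, A k (tnth w k)] =
  (\prod_k normal_prob (0 : R) 1 (A k))%E.
Proof.
elim: d A => [|d IH] A mA.
  by rewrite big_ord0 /= diracE mem_set// => -[].
rewrite big_ord_recl -(IH (fun k => A (lift ord0 k)))//.
set B := [set w : d.-tuple M | forall k, A (lift ord0 k) (tnth w k)].
have mB : measurable B.
  have -> : B = \bigcap_(k in [set: 'I_d])
      ((fun w : d.-tuple M => tnth w k) @^-1` A (lift ord0 k)).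
    by apply/seteqP; split=> w /= h k; [move=> _|]; exact: h.
  apply: fin_bigcap_measurable => [|k _]; first exact: finite_finset.
  rewrite -[X in measurable X]setTI.
  exact: (measurable_tnth k measurableT (mA (lift ord0 k))).
rewrite -(product_measure1E (normal_prob (0 : R) 1) (std_gaussian d)
  (mA ord0) mB).
apply: (congr1 (normal_prob (0 : R) 1 \x std_gaussian d)%E (_ :
             @tuple_cons d @^-1` [set w | forall k, A k (tnth w k)] =
             A ord0 `*` B)).
apply/seteqP; split=> -[x w] /=.
  move=> h; split; first by have := h ord0; rewrite (tnth_nth x).
  by move=> k; have := h (lift ord0 k); rewrite !(tnth_nth x).
move=> [hx hw] k; case: (unliftP ord0 k) => [j ->|->].
  by have := hw j; rewrite !(tnth_nth x).
by rewrite (tnth_nth x).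
Qed.

End gaussian_vector.

Section kernels.
Context {R : realType}.
Implicit Types (s : R -> R) (k l : nat).

Definition gauss_mean (f : R -> R) : R :=
  \int[normal_prob (0 : R) 1]_x f x.

Definition norm2 s : R := Num.sqrt (gauss_mean (fun x => s x ^+ 2)).

Definition norm4 s : R := gauss_mean (fun x => s x ^+ 4) `^ (4^-1).

(* Normalized (unit norm in L^2(N(0,1))) probabilists' Hermite polynomial *)
Definition hermite k (x : R) : R :=
  (Num.sqrt k`!%:R)^-1 * (-1) ^+ k * expR (x ^+ 2 / 2) *
  derive1n k (fun y : R => expR (- (y ^+ 2 / 2))) x.

Definition zeta k s : R := gauss_mean (fun x => s x * hermite k x).

(* sigma_{>l}^2, a square in name only: it is this difference *)
Definition sigma_gt2 l s : R := norm2 s ^+ 2 - \sum_(k < l.+1) zeta k s ^+ 2.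

Definition kernel_mx s d n (X : 'M[R]_(d, n)) : 'M[R]_n :=
  \matrix_(i, j) \int[std_gaussian d]_w
    (s (\sum_k tnth w k * X k i) * s (\sum_k tnth w k * X k j)).

Definition kernel_trunc_mx l s d n (X : 'M[R]_(d, n)) : 'M[R]_n :=
  \sum_(k < l.+1) zeta k s ^+ 2 *: hadamard_pow k (gram X)
  + (sigma_gt2 l s)%:M.

End kernels.

(* Main.v *)
Require Import Defs.
From mathcomp Require Import all_boot all_order all_algebra.
From mathcomp Require Import all_classical all_reals all_analysis.
From mathcomp Require Import measurable_realfun ring lra.
From mathcomp Require complex.

(* Off the diagonal, K_ij = E[s(u) s(v)] for a standard Gaussian pair (u, v) of
   correlation rho = <x_i, x_j>.  The density M of this pair with respect to the
   product gamma (x) gamma of its marginals satisfies <M, h_k (x) h_k> = rho^k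
   and ||M||^2 = 1 / (1 - rho^2), so that by Cauchy-Schwarz
     |K_ij - sum_(k <= l) zeta_k^2 rho^k|
       = |<s (x) s, M - sum_(k <= l) rho^k h_k (x) h_k>|
      <= ||s||_2^2 (1 / (1 - rho^2) - sum_(k <= l) rho^(2k))^(1/2)
       = ||s||_2^2 |rho|^(l+1) / (1 - rho^2)^(1/2),
   which is at most sqrt 2 ||s||_4^2 |rho|^(l+1) when |rho| <= 1 / sqrt 2.  As the
   norm of M is known exactly, the completeness of the Hermite polynomials plays
   no role.  Summing the squares bounds the Frobenius norm of K_l - K; the bound on
   the eigenvalues of K follows because K_l - sigma_{>l}^2 Id is positive
   semidefinite (Schur product). *)

Set Implicit Arguments.
Unset Strict Implicit.
Unset Printing Implicit Defensive.

Import Order.TTheory GRing.Theory Num.Theory.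
Import numFieldNormedType.Exports.

Local Open Scope classical_set_scope.
Local Open Scope ring_scope.

(** * Changes of variables for the normal law *)

(** That [K_ij] depends on the data only through [rho] must be extracted from the recursive
    [std_gaussian]. Each new coordinate is absorbed by two planar rotations that bring the pair back
    to the triangular form (p z1, q z1 + r z2); invariance under rotation comes in turn from
    translation invariance of Lebesgue measure, by way of shears. The identity <M, h_k (x) h_k> =
    rho^k says that averaging h_k(rho x + r z) over z multiplies h_k(x) by rho^k. This and the
    orthonormality of the h_k both come from Stein's identity E[x p(x)] = E[p'(x)]. The density M
    requires |rho| < 1, so the diagonal is separate: there the pair collapses, K_ii = ||s||_2^2, and
    sigma_{>l}^2 is exactly what makes the diagonals of K and K_l agree. Constants: |rho| <= 1 /
    sqrt 2 gives 1 - rho^2 >= 1/2, hence the factor sqrt 2, and the fourth moment enters through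
    ||s||_2 <= ||s||_4. Then sqrt 2 / 4 = 1 / (2 sqrt 2) <= 1/2, so the perturbation costs at most
    half of sigma_{>l}^2. *)

Section change_of_variables.
Context {R : realType}.
Local Notation leb := (@lebesgue_measure R).
Local Notation M := (measurableTypeR R).
Local Notation gam := (normal_prob (0 : R) (1 : R)).
Local Open Scope ereal_scope.
Import HBNNSimple.

Lemma integral_normal_prob (m s : R) (f : M -> \bar R) :
  measurable_fun [set: M] f -> (forall x, 0 <= f x) ->
  \int[normal_prob m s]_x f x = \int[leb]_x (f x * (normal_pdf m s x)%:E).
Proof.
move=> mf f0; pose nu := normal_prob m s; pose g x := (normal_pdf m s x)%:E.
have g0 x : 0 <= g x by rewrite lee_fin normal_pdf_ge0.
have mg : measurable_fun [set: M] g.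
  by apply/measurable_EFinP; exact: measurable_normal_pdf.
have indicE (A : set M) : measurable A ->
    \int[nu]_x (\1_A x)%:E = \int[leb]_x ((\1_A x)%:E * g x).
  move=> mA; rewrite integral_indic// setIT [LHS]integral_mkcond.
  apply: eq_integral => x _; rewrite patchE indicE; case: ifPn => _.
    by rewrite mul1e.
  by rewrite mul0e.
have sfunE (h : {nnsfun M >-> R}) :
    \int[nu]_x (h x)%:E = \int[leb]_x ((h x)%:E * g x).
  have h0 r x : 0 <= (r * \1_(h @^-1` [set r]) x)%:E by exact: nnfun_muleindic_ge0.
  have mh r : measurable_fun [set: M] (fun x => (r * \1_(h @^-1` [set r]) x)%:E).
    by apply/measurable_EFinP/measurable_funM.
  under eq_integral do rewrite fimfunE -fsumEFin//.
  rewrite ge0_integral_fsum//.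
  transitivity (\int[leb]_x
      \sum_(r \in range h) ((r * \1_(h @^-1` [set r]) x)%:E * g x)).
    rewrite ge0_integral_fsum//; last 2 first.
    - by move=> r; exact: emeasurable_funM.
    - by move=> r x _; exact: mule_ge0.
    apply: eq_fsbigr => r; rewrite inE => -[x _ <-].
    under eq_integral do rewrite EFinM.
    rewrite ge0_integralZl//; last 2 first.
    - exact/measurable_EFinP.
    - by rewrite lee_fin.
    rewrite indicE// -ge0_integralZl//; last 3 first.
    - by apply: emeasurable_funM => //; apply/measurable_EFinP.
    - by move=> y _; rewrite mule_ge0// lee_fin.
    - by rewrite lee_fin.
    by apply: eq_integral => y _; rewrite EFinM muleA.
  apply: eq_integral => x _; rewrite fimfunE -fsumEFin// ge0_mule_fsuml//.
pose h := nnsfun_approx measurableT mf.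
have hf x : (h n x)%:E @[n --> \oo] --> f x by exact: cvg_nnsfun_approx.
have nd_h x n p : (n <= p)%N -> (h n x <= h p x)%R.
  by move=> np; exact/lefP/nd_nnsfun_approx.
transitivity (limn (fun n => \int[nu]_x (h n x)%:E)).
  rewrite -monotone_convergence//.
  - by apply: eq_integral => x _; apply/esym/cvg_lim.
  - by move=> n; apply/measurable_EFinP.
  - by move=> n x _; rewrite lee_fin.
  - by move=> x _ n p np; rewrite lee_fin nd_h.
under eq_fun do rewrite sfunE.
rewrite -monotone_convergence//.
- apply: eq_integral => x _; apply/cvg_lim => //.
  by apply: cvgeZr => //; exact: hf.
- by move=> n; apply: emeasurable_funM => //; apply/measurable_EFinP.
- by move=> n x _; rewrite mule_ge0// lee_fin.
- by move=> x _ n p np; rewrite lee_wpmul2r// lee_fin nd_h.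
Qed.

(** The image of Lebesgue measure under [x |-> m + r * x], multiplied by [r], gives each interval
    []a, b]] its length, so it is Lebesgue measure by uniqueness. *)
Lemma integral_affine (m r : R) (f : M -> \bar R) : (0 < r)%R ->
  measurable_fun [set: M] f -> (forall x, 0 <= f x) ->
  \int[leb]_x f x = r%:E * \int[leb]_x f (m + r * x)%R.
Proof.
move=> r0 mf f0; pose phi (x : M) : M := (m + r * x)%R.
have mphi : measurable_fun [set: M] phi.
  by apply: measurable_funD => //; apply: measurable_funM.
pose nr := NngNum (ltW r0).
pose nu : {measure set M -> \bar R} :=
  measure_function_pushforward__canonical__measure_function_Measure leb mphi.
transitivity (\int[mscale nr nu]_x f x).
  apply: eq_measure_integral => //= A mA _.
  apply: (@lebesgue_measure_unique R (mscale nr nu)) => //.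
  move=> _ [[a b]] _ <-; rewrite /= /mscale/= /pushforward/=.
  have -> : phi @^-1` `]a, b] = `]((a - m) / r)%R, ((b - m) / r)%R]%classic.
    apply/seteqP; split=> x /=; rewrite !in_itv/= /phi ltr_pdivrMr// ler_pdivlMr//;
      by rewrite ltrBlDl lerBrDl (mulrC x).
  rewrite !lebesgue_measure_itv/= !lte_fin ltr_pM2r ?invr_gt0// ltrD2r.
  case: ifPn => _; last by rewrite mule0.
  by rewrite -!EFinD -EFinM; congr EFin; field; rewrite gt_eqF.
by rewrite ge0_integral_mscale//= ge0_integral_pushforward.
Qed.

Lemma integral_std_normal_affine (m r : R) (f : M -> \bar R) : (0 < r)%R ->
  measurable_fun [set: M] f -> (forall x, 0 <= f x) ->
  \int[gam]_x f (m + r * x)%R = \int[normal_prob m r]_x f x.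
Proof.
move=> r0 mf f0; have mphi : measurable_fun [set: M] (fun x : M => m + r * x : M)%R.
  by apply: measurable_funD => //; apply: measurable_funM.
have mfphi : measurable_fun [set: M] (fun x : M => f (m + r * x)%R).
  exact: (measurableT_comp mf mphi).
have mp : measurable_fun [set: M] (fun x => f x * (normal_pdf m r x)%:E).
  by apply: emeasurable_funM => //; apply/measurable_EFinP;
    exact: measurable_normal_pdf.
have p0 x : 0 <= f x * (normal_pdf m r x)%:E.
  by rewrite mule_ge0// lee_fin normal_pdf_ge0.
rewrite (integral_normal_prob _ _ mfphi (fun=> f0 _)) (integral_normal_prob _ _ mf f0).
rewrite [RHS](integral_affine m r0 mp p0) -ge0_integralZl//; last 2 first.
- exact: (measurableT_comp mp mphi).
- by rewrite lee_fin ltW.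
apply: eq_integral => x _; rewrite muleCA -EFinM; congr (_ * _%:E).
rewrite !normal_pdfE ?gt_eqF// /normal_peak /normal_fun mulrA.
congr (_ * expR _)%R; last by field; rewrite gt_eqF.
rewrite expr1n mul1r -mulrnAr sqrtrM ?sqr_ge0// sqrtr_sqr gtr0_norm//.
by rewrite invfM mulrA mulfV ?gt_eqF ?mul1r.
Qed.

End change_of_variables.

(** * Rotation invariance of the planar Gaussian measure *)

Section rotation.
Context {R : realType}.
Local Notation leb := (@lebesgue_measure R).
Local Notation M := (measurableTypeR R).
Local Notation gam := (normal_prob (0 : R) (1 : R)).
Local Open Scope ereal_scope.

Lemma measurable_linear_comb (a b : R) :
  measurable_fun [set: M * M] (fun z : M * M => a * z.1 + b * z.2 : M)%R.
Proof.
by apply: measurable_funD; apply: measurable_funM.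
Qed.

Lemma measurable_linear_map (a b u v : R) :
  measurable_fun [set: M * M]
    (fun z : M * M => (a * z.1 + b * z.2, u * z.1 + v * z.2) : M * M)%R.
Proof. by apply/measurable_fun_pair; exact: measurable_linear_comb. Qed.

Lemma integral_translation (a : R) (f : M -> \bar R) :
  measurable_fun [set: M] f -> (forall x, 0 <= f x) ->
  \int[leb]_x f (x + a)%R = \int[leb]_x f x.
Proof.
move=> mf f0; rewrite [RHS](integral_affine a ltr01 mf f0) mul1e.
by apply: eq_integral => x _; rewrite mul1r addrC.
Qed.

Section shear.
Variable F : M * M -> \bar R.
Hypotheses (mF : measurable_fun [set: M * M] F) (F0 : forall z, 0 <= F z).

Lemma integral_shear_snd (t : R) :
  \int[leb]_x \int[leb]_y F (x, y + t * x)%R = \int[leb]_x \int[leb]_y F (x, y).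
Proof.
apply: eq_integral => x _.
apply: (@integral_translation _ (fun y => F (x, y))) => //.
exact: measurableT_comp.
Qed.

(** Tonelli makes the sheared variable the inner one, where the shear is a translation. *)
Lemma integral_shear_fst (t : R) :
  \int[leb]_x \int[leb]_y F (x + t * y, y)%R = \int[leb]_x \int[leb]_y F (x, y).
Proof.
have mG : measurable_fun [set: M * M] (fun z : M * M => F (z.1 + t * z.2, z.2)%R).
  apply: measurableT_comp => //; apply/measurable_fun_pair => //.
  by apply: measurable_funD => //; apply: measurable_funM.
rewrite (fubini_tonelli (m1:=leb) (m2:=leb) _ mG (fun=> F0 _)).
rewrite (fubini_tonelli (m1:=leb) (m2:=leb) _ mF F0).
apply: eq_integral => y _.
rewrite /=; apply: (@integral_translation _ (fun x => F (x, y))) => //.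
exact: measurableT_comp.
Qed.

End shear.

Section lebesgue_rotation.
Variable F : M * M -> \bar R.
Hypotheses (mF : measurable_fun [set: M * M] F) (F0 : forall z, 0 <= F z).
Variables c s : R.
Hypothesis cs1 : (c ^+ 2 + s ^+ 2 = 1)%R.

(* A rotation of angle theta other than pi is a product of three shears, of
   slopes tan (theta/2), - sin theta, tan (theta/2). *)
Lemma integral_rotation_shears : (1 + c != 0)%R ->
  \int[leb]_x \int[leb]_y F (c * x + s * y, c * y - s * x)%R =
  \int[leb]_x \int[leb]_y F (x, y).
Proof.
move=> c1; pose t := (s / (1 + c))%R.
have ts : (1 - t * s = c)%R.
  have s2 : (s ^+ 2 = 1 - c ^+ 2)%R by rewrite -cs1 addrC addKr.
  by rewrite /t; field: s2.
have tc : (t * (1 + c) = s)%R by rewrite /t divfK.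
pose F1 (z : M * M) := F (z.1 + t * z.2, z.2)%R.
have mF1 : measurable_fun [set: M * M] F1.
  apply: measurableT_comp => //; apply/measurable_fun_pair => //.
  by apply: measurable_funD => //; apply: measurable_funM.
pose F2 (z : M * M) := F1 (z.1, z.2 + (- s) * z.1)%R.
have mF2 : measurable_fun [set: M * M] F2.
  apply: measurableT_comp => //; apply/measurable_fun_pair => //.
  by apply: measurable_funD => //; apply: measurable_funM.
rewrite -(integral_shear_fst mF F0 t).
rewrite -(@integral_shear_snd F1 mF1 (fun=> F0 _) (- s)).
rewrite -(@integral_shear_fst F2 mF2 (fun=> F0 _) t).
apply: eq_integral => x _; apply: eq_integral => y _; rewrite /F2 /F1/=.
congr (F (_, _)).
  transitivity ((1 - t * s) * x + t * (1 + (1 - t * s)) * y)%R; last by ring.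
  by rewrite ts tc.
by transitivity ((1 - t * s) * y - s * x)%R; [rewrite ts|ring].
Qed.

End lebesgue_rotation.

Let gauss_density (z : M * M) : \bar R :=
  (normal_pdf 0 1 z.1 * normal_pdf 0 1 z.2)%:E.

Let gauss_density_ge0 z : 0 <= gauss_density z.
Proof. by rewrite lee_fin mulr_ge0 ?normal_pdf_ge0. Qed.

Let measurable_gauss_density : measurable_fun [set: M * M] gauss_density.
Proof.
apply/measurable_EFinP; apply: measurable_funM;
  by apply: measurableT_comp => //; exact: measurable_normal_pdf.
Qed.

Lemma integral_gauss2 (F : M * M -> \bar R) :
  measurable_fun [set: M * M] F -> (forall z, 0 <= F z) ->
  \int[gam \x gam]_z F z =
  \int[leb]_x \int[leb]_y
    (F (x, y) * (normal_pdf 0 1 x * normal_pdf 0 1 y)%:E).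
Proof.
move=> mF F0; rewrite (fubini_tonelli1 (m1:=gam) (m2:=gam) _ mF F0).
have mFF := measurable_fun_fubini_tonelli_F (m2:=gam) _ mF F0.
rewrite (integral_normal_prob _ _ mFF); last by move=> x; exact: integral_ge0.
apply: eq_integral => x _; rewrite /fubini_F.
have mFx : measurable_fun [set: M] (fun y => F (x, y)) by exact: measurableT_comp.
rewrite (integral_normal_prob _ _ mFx (fun=> F0 _)) -ge0_integralZr//; last 3 first.
- apply: emeasurable_funM => //; apply/measurable_EFinP.
  exact: measurable_normal_pdf.
- by move=> y _; rewrite mule_ge0// lee_fin normal_pdf_ge0.
- by rewrite lee_fin normal_pdf_ge0.
by apply: eq_integral => y _; rewrite -muleA -EFinM mulrC.
Qed.

(** The Gaussian density is a function of x^2 + y^2, which a rotation preserves, so the claim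
    reduces to the rotation invariance of Lebesgue measure. *)
Let integral_gauss2_rotation_shears (F : M * M -> \bar R) (c s : R) :
  measurable_fun [set: M * M] F -> (forall z, 0 <= F z) ->
  (c ^+ 2 + s ^+ 2 = 1)%R -> (1 + c != 0)%R ->
  \int[gam \x gam]_z F (c * z.1 + s * z.2, (- s) * z.1 + c * z.2)%R =
  \int[gam \x gam]_z F z.
Proof.
move=> mF F0 cs1 c1.
have mFr : measurable_fun [set: M * M] (fun z : M * M =>
    F (c * z.1 + s * z.2, (- s) * z.1 + c * z.2)%R).
  by apply: (measurableT_comp mF); exact: measurable_linear_map.
rewrite (integral_gauss2 mF F0) (integral_gauss2 mFr (fun=> F0 _)).
pose G z := F z * gauss_density z.
have mG : measurable_fun [set: M * M] G by exact: emeasurable_funM.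
have G0 z : 0 <= G z by rewrite mule_ge0.
rewrite -[RHS](integral_rotation_shears mG G0 cs1 c1).
apply: eq_integral => x _; apply: eq_integral => y _.
rewrite /G /gauss_density/= mulNr [(- (s * x) + c * y)%R]addrC.
congr (_ * _%:E); rewrite !normal_pdfE ?oner_eq0// /normal_fun !subr0.
rewrite !mulrA ![(_ * normal_peak 1)%R]mulrC !mulrA -!mulrA -!expRD.
congr (_ * (_ * expR _))%R; rewrite !mulNr -!opprD -!mulrDl; congr (- (_ / _))%R.
by rewrite -[LHS]mul1r -cs1; ring.
Qed.

Lemma integral_gauss2_rotation (F : M * M -> \bar R) (c s : R) :
  measurable_fun [set: M * M] F -> (forall z, 0 <= F z) ->
  (c ^+ 2 + s ^+ 2 = 1)%R ->
  \int[gam \x gam]_z F (c * z.1 + s * z.2, (- s) * z.1 + c * z.2)%R =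
  \int[gam \x gam]_z F z.
Proof.
move=> mF F0 cs1; have [c1|] := eqVneq (1 + c)%R 0%R; last first.
  exact: integral_gauss2_rotation_shears.
have cN1 : (c = -1)%R by apply/eqP; rewrite -subr_eq0 opprK addrC c1.
have s0 : (s = 0)%R.
  apply/eqP; rewrite -sqrf_eq0; apply/eqP.
  by rewrite -(addKr (c ^+ 2)%R (s ^+ 2)%R) cs1 cN1 sqrrN expr1n addNr.
(* the half turn is twice the quarter turn *)
have q1 : ((0 : R) ^+ 2 + 1 ^+ 2 = 1)%R by rewrite expr0n/= expr1n add0r.
have q0 : (1 + 0 != 0 :> R)%R by rewrite addr0 oner_eq0.
have mFr : measurable_fun [set: M * M] (fun z : M * M =>
    F (0 * z.1 + 1 * z.2, (- 1) * z.1 + 0 * z.2)%R).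
  by apply: (measurableT_comp mF); exact: measurable_linear_map.
rewrite -[RHS](integral_gauss2_rotation_shears mF F0 q1 q0).
rewrite -[RHS](integral_gauss2_rotation_shears mFr (fun=> F0 _) q1 q0).
apply: eq_integral => z _; rewrite cN1 s0 /=; congr (F (_, _))%R; ring.
Qed.

End rotation.

(** * Law of a pair of Gaussian projections *)

(** A Givens rotation: substituting (c z1 + s z2, - s z1 + c z2) into the form a z1 + b z2 leaves a
    nonnegative multiple of z1. This is what eliminates one Gaussian variable at a time. *)
Lemma rotation_to_axis (R : rcfType) (a b : R) : exists c s : R,
  [/\ c ^+ 2 + s ^+ 2 = 1, a * c - b * s = Num.sqrt (a ^+ 2 + b ^+ 2)
    & a * s + b * c = 0].
Proof.
set n := Num.sqrt _; have n2 : n ^+ 2 = a ^+ 2 + b ^+ 2.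
  by rewrite sqr_sqrtr// addr_ge0 ?sqr_ge0.
have [n0|n0] := eqVneq n 0.
  have : a ^+ 2 + b ^+ 2 == 0 by rewrite -n2 n0 expr0n.
  rewrite paddr_eq0 ?sqr_ge0// !sqrf_eq0 => /andP[/eqP-> /eqP->].
  by exists 1, 0; split; rewrite ?n0; ring.
exists (a / n), (- b / n); split.
- by rewrite !expr_div_n sqrrN -mulrDl -n2 divff// sqrf_eq0.
- by rewrite mulrA mulrA -mulrBl mulrN opprK -!expr2 -n2 expr2 mulfK.
- by field.
Qed.

Section gaussian_pair.
Context {R : realType}.
Local Notation M := (measurableTypeR R).
Local Notation gam := (normal_prob (0 : R) (1 : R)).

Lemma measurable_tuple_dot d (a : 'I_d -> R) :
  measurable_fun [set: d.-tuple M]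
    (fun w : d.-tuple M => \sum_k tnth w k * a k : M).
Proof.
apply: measurable_sum => k; apply: measurable_funM => //.
exact: measurable_tnth.
Qed.

Let measurable_affine3 (F : M * M -> \bar R) (a1 a2 a3 b1 b2 b3 : R) :
  measurable_fun [set: M * M] F ->
  measurable_fun [set: (M * M) * M] (fun z : (M * M) * M =>
    F (a1 * z.1.1 + a2 * z.1.2 + a3 * z.2, b1 * z.1.1 + b2 * z.1.2 + b3 * z.2)).
Proof.
move=> mF; apply: (measurableT_comp mF).
have m1 : measurable_fun [set: (M * M) * M] (fun z : (M * M) * M => z.1.1).
  exact: (measurableT_comp measurable_fst measurable_fst).
have m2 : measurable_fun [set: (M * M) * M] (fun z : (M * M) * M => z.1.2).
  exact: (measurableT_comp measurable_snd measurable_fst).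
by apply/measurable_fun_pair; (apply: measurable_funD; first
  apply: measurable_funD); apply: measurable_funM.
Qed.

Local Open Scope ereal_scope.

Lemma integral_probability_cst dT (T : measurableType dT) (P : probability T R)
  (y : \bar R) : \int[P]_x y = y.
Proof. by rewrite integral_cst// [X in _ * X]probability_setT mule1. Qed.

(* The coefficients are those of the Cholesky factorization of the Gram matrix
   of [a] and [b]. *)
Lemma std_gaussian_pair d (a b : 'I_d -> R) : exists p q r : R,
  [/\ (0 <= p)%R, (0 <= r)%R,
      [/\ p ^+ 2 = \sum_k a k ^+ 2, p * q = \sum_k a k * b k
        & q ^+ 2 + r ^+ 2 = \sum_k b k ^+ 2]%R
    & forall F : M * M -> \bar R,
      measurable_fun [set: M * M] F -> (forall z, 0 <= F z) ->
      \int[std_gaussian d]_w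
        F (\sum_k tnth w k * a k, \sum_k tnth w k * b k)%R =
      \int[gam \x gam]_z F (p * z.1, q * z.1 + r * z.2)%R].
Proof.
elim: d a b => [a b|d IH a b].
  exists 0%R, 0%R, 0%R; split => //.
    by rewrite !big_ord0; split; ring.
  move=> F mF F0.
  transitivity (\int[std_gaussian 0]_w F (0, 0)%R).
    by apply: eq_integral => w _; rewrite !big_ord0.
  transitivity (\int[gam \x gam]_z F (0, 0)%R).
    by rewrite (integral_probability_cst (std_gaussian 0))
      (integral_probability_cst (gam \x gam)%E).
  by apply: eq_integral => z _; rewrite !mul0r addr0.
have [p [q [r [p0 r0 [pE qE rE] law]]]] :=
  IH (fun k => a (lift ord0 k)) (fun k => b (lift ord0 k)).
set a0 := a ord0; set b0 := b ord0.
(* By induction the tail gives (p z, q z + r u); with the head t the pair is (a0 t + p z, b0 t + q z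
   + r u). This rotation, in (t, z), removes z from the first entry and turns the second into q' t +
   v z + r u; the next one, in (z, u), merges v z + r u into r' z. *)
have [c [s [cs1 cs2 cs3]]] := rotation_to_axis a0 p.
set p' := Num.sqrt _ in cs2.
pose q' := (b0 * c - q * s)%R; pose v := (b0 * s + q * c)%R.
have [c' [s' [cs1' cs2' cs3']]] := rotation_to_axis v r.
set r' := Num.sqrt _ in cs2'.
exists p', q', r'; split; rewrite ?sqrtr_ge0//.
  rewrite !big_ord_recl/= -/a0 -/b0 -pE -qE -rE; split.
  - by rewrite sqr_sqrtr// addr_ge0 ?sqr_ge0.
  (* The inner product of the rotated vectors (p', 0) and (q', v), which equals that of (a0, p) and
     (b0, q). *)
  - transitivity ((a0 * c - p * s) * q' + (a0 * s + p * c) * v)%R.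
      by rewrite cs2 cs3 mul0r addr0.
    transitivity ((c ^+ 2 + s ^+ 2) * (a0 * b0 + p * q))%R; last first.
      by rewrite cs1 mul1r.
    by rewrite /q' /v; ring.
  - rewrite sqr_sqrtr ?addr_ge0 ?sqr_ge0//.
    transitivity ((c ^+ 2 + s ^+ 2) * (b0 ^+ 2 + q ^+ 2) + r ^+ 2)%R.
      by rewrite /q' /v; ring.
    by rewrite cs1 mul1r addrA.
move=> F mF F0.
have mG : measurable_fun [set: d.+1.-tuple M] (fun w : d.+1.-tuple M =>
    F (\sum_k tnth w k * a k, \sum_k tnth w k * b k)%R).
  by apply: (measurableT_comp mF); apply/measurable_fun_pair;
    exact: measurable_tuple_dot.
have mGc := measurableT_comp mG (measurable_tuple_cons (d := d)).
rewrite /= ge0_integral_distribution//.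
(* With u integrated out, the first rotation acts on a function of two variables. *)
pose H (t z : M) := \int[gam]_u F (a0 * t + p * z + 0 * u, b0 * t + q * z + r * u)%R.
have mH : measurable_fun [set: M * M] (fun z : M * M => H z.1 z.2).
  apply: (@measurable_fun_fubini_tonelli_F _ _ _ _ _ gam (fun z : (M * M) * M =>
    F (a0 * z.1.1 + p * z.1.2 + 0 * z.2, b0 * z.1.1 + q * z.1.2 + r * z.2)%R)) => //.
  exact: measurable_affine3.
have H0 t z : 0 <= H t z by exact: integral_ge0.
transitivity (\int[gam \x gam]_z H z.1 z.2).
  rewrite (fubini_tonelli1 (m1 := gam) (m2 := std_gaussian d) _ mGc (fun=> F0 _)).
  rewrite (fubini_tonelli1 (m1 := gam) (m2 := gam) _ mH (fun=> H0 _ _)).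
  apply: eq_integral => t _; rewrite /fubini_F /=.
  pose Ft (z : M * M) := F (a0 * t + z.1, b0 * t + z.2)%R.
  have mFt : measurable_fun [set: M * M] Ft.
    apply: (measurableT_comp mF); apply/measurable_fun_pair;
      by apply: measurable_funD.
  transitivity (\int[std_gaussian d]_w Ft (\sum_k tnth w k * a (lift ord0 k),
      \sum_k tnth w k * b (lift ord0 k))%R).
    apply: eq_integral => w _; rewrite /Ft /= !big_ord_recl !(tnth_nth t)/=.
    congr (F (_ + _, _ + _))%R; rewrite 1?mulrC//;
      by apply: eq_bigr => k _; rewrite !(tnth_nth t).
  have mGt := measurableT_comp mFt (measurable_linear_map p 0 q r).
  transitivity (\int[gam \x gam]_z
      Ft (p * z.1 + 0 * z.2, q * z.1 + r * z.2)%R).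
    by rewrite (law _ mFt (fun=> F0 _)); apply: eq_integral => z _; rewrite mul0r addr0.
  rewrite (fubini_tonelli1 (m1 := gam) (m2 := gam) _ mGt (fun=> F0 _)).
  apply: eq_integral => z _; apply: eq_integral => u _.
  by rewrite /Ft /= !addrA.
rewrite -(integral_gauss2_rotation mH (fun=> H0 _ _) cs1).
have mHr : measurable_fun [set: M * M] (fun z : M * M =>
    H (c * z.1 + s * z.2, - s * z.1 + c * z.2).1
      (c * z.1 + s * z.2, - s * z.1 + c * z.2).2)%R.
  exact: (measurableT_comp mH (measurable_linear_map c s (- s) c)).
have mFr := measurableT_comp mF (measurable_linear_map p' 0 q' r').
transitivity (\int[gam \x gam]_z
  F (p' * z.1 + 0 * z.2, q' * z.1 + r' * z.2)%R); last first.
  by apply: eq_integral => z _; rewrite mul0r addr0.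
rewrite (fubini_tonelli1 (m1 := gam) (m2 := gam) _ mHr (fun=> H0 _ _)).
rewrite (fubini_tonelli1 (m1 := gam) (m2 := gam) _ mFr (fun=> F0 _)).
apply: eq_integral => t _; rewrite /fubini_F /=.
pose Kt (z : M * M) := F (p' * t, q' * t + (v * z.1 + r * z.2))%R.
have mKt : measurable_fun [set: M * M] Kt.
  apply: (measurableT_comp mF); apply/measurable_fun_pair => //.
  by apply: measurable_funD => //; exact: measurable_linear_comb.
transitivity (\int[gam \x gam]_z Kt z).
  rewrite (fubini_tonelli1 (m1 := gam) (m2 := gam) _ mKt (fun=> F0 _)).
  apply: eq_integral => z _; apply: eq_integral => u _; rewrite /Kt /=.
  rewrite -cs2; congr (F (_, _)); last by rewrite /q' /v; ring.
  transitivity ((a0 * c - p * s) * t + (a0 * s + p * c) * z)%R; first by ring.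
  by rewrite cs3 mul0r addr0.
rewrite -(integral_gauss2_rotation mKt (fun=> F0 _) cs1').
have mKr := measurableT_comp mKt (measurable_linear_map c' s' (- s') c').
rewrite (fubini_tonelli1 (m1 := gam) (m2 := gam) _ mKr (fun=> F0 _)).
apply: eq_integral => z _; rewrite /fubini_F.
transitivity (\int[gam]_u F (p' * t, q' * t + r' * z)%R).
  apply: eq_integral => u _; rewrite /Kt /=; congr (F (_, _ + _))%R.
  transitivity ((v * c' - r * s') * z + (v * s' + r * c') * u)%R; first by ring.
  by rewrite cs2' cs3' mul0r addr0.
by rewrite (integral_probability_cst gam) /= mul0r addr0.
Qed.

End gaussian_pair.

(** * Densities and integrability *)

Section density.
Context {R : realType}.
Local Notation leb := (@lebesgue_measure R).
Local Notation M := (measurableTypeR R).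
Local Notation gam := (normal_prob (0 : R) (1 : R)).
Local Open Scope ereal_scope.

Lemma funepos_mulr_ge0 (T : Type) (f : T -> \bar R) (w : T -> R) :
  (forall x, (0 <= w x)%R) ->
  (fun x => f x * (w x)%:E)^\+ = (fun x => f^\+ x * (w x)%:E).
Proof.
move=> w0; apply/funext => x; rewrite !funeposE !(muleC _ (w x)%:E).
by rewrite maxe_pMr ?lee_fin ?mule0.
Qed.

Lemma funeneg_mulr_ge0 (T : Type) (f : T -> \bar R) (w : T -> R) :
  (forall x, (0 <= w x)%R) ->
  (fun x => f x * (w x)%:E)^\- = (fun x => f^\- x * (w x)%:E).
Proof.
move=> w0; apply/funext => x; rewrite !funenegE !(muleC _ (w x)%:E) -muleN.
by rewrite maxe_pMr ?lee_fin ?mule0.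
Qed.

Lemma integral_normal_prob_density (m s : R) (f : M -> \bar R) :
  measurable_fun [set: M] f ->
  \int[normal_prob m s]_x f x = \int[leb]_x (f x * (normal_pdf m s x)%:E).
Proof.
move=> mf; have w0 := normal_pdf_ge0 m s.
rewrite integralE [RHS]integralE funepos_mulr_ge0// funeneg_mulr_ge0//.
by rewrite !integral_normal_prob//;
  [exact: measurable_funeneg|exact: measurable_funepos].
Qed.

Lemma integrable_normal_prob_density (m s : R) (f : M -> \bar R) :
  measurable_fun [set: M] f ->
  (normal_prob m s).-integrable [set: M] f <->
  leb.-integrable [set: M] (fun x => f x * (normal_pdf m s x)%:E).
Proof.
move=> mf; have w0 := normal_pdf_ge0 m s.
have mfw : measurable_fun [set: M] (fun x => f x * (normal_pdf m s x)%:E).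
  by apply: emeasurable_funM => //; apply/measurable_EFinP;
    exact: measurable_normal_pdf.
have E : \int[normal_prob m s]_x `|f x| = \int[leb]_x `|f x * (normal_pdf m s x)%:E|.
  rewrite integral_normal_prob//; last exact: measurableT_comp.
  apply: eq_integral => x _.
  by rewrite abseM [`|(normal_pdf _ _ _)%:E|]gee0_abs ?lee_fin.
by split=> /integrableP[_ fi]; apply/integrableP; split => //; [rewrite -E|rewrite E].
Qed.

End density.

(** * Integrability of functions of polynomial growth *)

Section integrability.
Context {R : realType}.
Local Notation leb := (@lebesgue_measure R).
Local Notation M := (measurableTypeR R).
Local Notation gam := (normal_prob (0 : R) (1 : R)).
Local Notation itg f := (gam.-integrable [set: M] (EFin \o f)).

Lemma std_normal_pdfE (x : R) :
  normal_pdf 0 1 x = normal_peak 1 * expR (- (x ^+ 2 / 2)).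
Proof.
by rewrite normal_pdfE ?oner_eq0// /normal_fun subr0 expr1n -mulr_natr mul1r mulNr.
Qed.

Lemma measurable_expR_sqr4 :
  measurable_fun [set: M] (fun x : M => expR (x ^+ 2 / 4) : M).
Proof. by apply: measurableT_comp => //; apply: measurable_funM. Qed.

(** Since x^2/4 - x^2/2 = - x^2/4, the product with the N(0, 1) density is a multiple of the N(0, 2)
    density. This envelope dominates every function of polynomial growth. *)
Lemma integrable_expR_sqr4 : itg (fun x => expR (x ^+ 2 / 4)).
Proof.
apply/integrable_normal_prob_density.
  by apply/measurable_EFinP; exact: measurable_expR_sqr4.
set s := Num.sqrt 2 : R; have s2 : s ^+ 2 = 2 by rewrite sqr_sqrtr.
have s0 : s != 0 by rewrite sqrtr_eq0 -ltNge.
apply: (@eq_integrable _ _ _ leb _ measurableT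
  (fun x => ((normal_peak 1 / normal_peak s)%:E * (normal_pdf 0 s x)%:E)%E)).
  move=> x _; rewrite /= -!EFinM; congr EFin; rewrite std_normal_pdfE.
  rewrite (normal_pdfE _ s0) /normal_fun subr0 s2 mulrA.
  rewrite divfK ?gt_eqF ?normal_peak_gt0//.
  rewrite mulrCA; congr (_ * _); rewrite -expRD; congr expR; by field.
by apply: integrableZl => //; exact: integrable_normal_pdf.
Qed.

Lemma integrable_expR_bound (f : M -> R) (C : R) : measurable_fun [set: M] f ->
  (forall x, `|f x| <= C * expR (x ^+ 2 / 4)) -> itg f.
Proof.
move=> mf fC; apply: (le_integrable measurableT _ _
  (integrableZl measurableT C integrable_expR_sqr4)).
  exact/measurable_EFinP.
move=> x _ /=; rewrite lee_fin; apply: (le_trans (fC x)).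
exact: ler_norm.
Qed.

(** The natural exponent, in place of the real one bounding the activation, makes the class visibly
    closed under products and makes it contain the polynomials. *)
Definition poly_growth (f : R -> R) :=
  exists C n, 0 <= C /\ forall x, `|f x| <= C * (1 + `|x|) ^+ n.

Lemma poly_growthM f g : poly_growth f -> poly_growth g -> poly_growth (f \* g).
Proof.
move=> [C [n [C0 fC]]] [D [m [D0 gD]]]; exists (C * D), (n + m)%N.
by split=> [|x]; rewrite ?mulr_ge0// normrM exprD mulrACA ler_pM.
Qed.

Lemma poly_growthD f g : poly_growth f -> poly_growth g -> poly_growth (f \+ g).
Proof.
move=> [C [n [C0 fC]]] [D [m [D0 gD]]]; exists (C + D), (n + m)%N.
split=> [|x]; rewrite ?addr_ge0// mulrDl; apply: (le_trans (ler_normD _ _)).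
have x1 : 1 <= 1 + `|x| by rewrite lerDl.
rewrite lerD//; [apply: (le_trans (fC x))|apply: (le_trans (gD x))];
  by rewrite ler_wpM2l// ler_weXn2l// ?leq_addr ?leq_addl.
Qed.

Lemma poly_growth_cst c : poly_growth (fun=> c).
Proof. by exists `|c|, 0%N; split=> // x; rewrite expr0 mulr1. Qed.

Lemma poly_growth_id : poly_growth id.
Proof. by exists 1, 1%N; split=> // x; rewrite mul1r expr1 lerDr. Qed.

Lemma poly_growthX f n : poly_growth f -> poly_growth (fun x => f x ^+ n).
Proof.
move=> gf; elim: n => [|n IH]; first exact: poly_growth_cst.
by under eq_fun do rewrite exprS; exact: poly_growthM.
Qed.

Lemma poly_growth_horner (p : {poly R}) : poly_growth (horner p).
Proof.
elim/poly_ind: p => [|p c IH].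
  rewrite (_ : horner 0 = cst 0); first exact: poly_growth_cst.
  by apply/funext => x; rewrite horner0.
rewrite (_ : horner _ = fun x => p.[x] * x + c); last first.
  by apply/funext => x; rewrite hornerMXaddC.
by apply: poly_growthD (poly_growth_cst c); apply: poly_growthM poly_growth_id.
Qed.

(** From the exponential series, (1 + |x|)^(n+1) <= (n+1)! exp(1 + |x|), and (|x|/2 - 1)^2 >= 0
    gives 1 + |x| <= 2 + x^2/4; hence the constant (n+1)! e^2. *)
Lemma poly_growth_expR_bound f : poly_growth f ->
  exists2 C, 0 <= C & forall x, `|f x| <= C * expR (x ^+ 2 / 4).
Proof.
move=> [C [n [C0 fC]]]; exists (C * (n.+1`!%:R * expR 2)).
  by rewrite !mulr_ge0 ?expR_ge0.
move=> x; apply: (le_trans (fC x)); rewrite -mulrA ler_wpM2l//.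
have x1 : 1 <= 1 + `|x| by rewrite lerDl.
apply: (le_trans (ler_weXn2l x1 (leqnSn n))).
rewrite -mulrA -expRD -ler_pdivrMl ?ltr0n ?fact_gt0//.
have := expR_ge1Dxn n (le_trans ler01 x1); rewrite mulrC => h.
apply: (le_trans _ (le_trans h _)); first by rewrite mulrC lerDr.
rewrite ler_expR -(real_normK (num_real x)).
have := sqr_ge0 (`|x| / 2 - 1); nra.
Qed.

Lemma integrable_poly_growth (f : M -> R) : measurable_fun [set: M] f ->
  poly_growth f -> itg f.
Proof.
by move=> mf /poly_growth_expR_bound[C _ fC]; exact: integrable_expR_bound fC.
Qed.

End integrability.

Section stein.
Context {R : realType}.
Local Notation leb := (@lebesgue_measure R).
Local Notation M := (measurableTypeR R).
Local Notation gam := (normal_prob (0 : R) (1 : R)).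

(** Kept without its normalizing factor, as this is the function differentiated in [hermite]. *)
Definition gauss_kernel (y : R) : R := expR (- (y ^+ 2 / 2)).

#[global] Instance is_derive_gauss_kernel (x : R) :
  is_derive x (1 : R) gauss_kernel (- x * gauss_kernel x).
Proof.
rewrite /gauss_kernel; apply: is_derive_eq.
by rewrite !scaler0 /GRing.scale/=; field.
Qed.

Lemma continuous_gauss_kernel : continuous gauss_kernel.
Proof.
by move=> x; apply/differentiable_continuous/derivable1_diffP/ex_derive.
Qed.

End stein.

(** * Stein's identity for polynomials *)

Section stein.
Context {R : realType}.
Local Notation leb := (@lebesgue_measure R).
Local Notation M := (measurableTypeR R).
Local Notation gam := (normal_prob (0 : R) (1 : R)).
Local Notation itg f := (gam.-integrable [set: M] (EFin \o f)).

Lemma integrable_horner (p : {poly R}) : itg (horner p).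
Proof.
apply: integrable_poly_growth; last exact: poly_growth_horner.
exact: measurable_poly.
Qed.

(** The derivative of [- p * gauss_kernel]; up to the factor [normal_peak 1], its integral is the
    difference of the two sides of Stein's identity. *)
Let h (p : {poly R}) x := ('X * p - p^`()).[x] * gauss_kernel x.

Let continuous_h p : continuous (h p).
Proof.
by move=> x; apply: cvgM; [exact: continuous_horner|exact: continuous_gauss_kernel].
Qed.

Let is_derive_antiderivative (p : {poly R}) (x : R) :
  is_derive x (1 : R) (fun y => - (p.[y] * gauss_kernel y)) (h p x).
Proof.
apply: is_derive_eq; rewrite /h /GRing.scale/= hornerD hornerN hornerM hornerX.
by ring.
Qed.

Let integral_segment (p : {poly R}) (a b : R) : a < b ->
  (\int[leb]_(x in `[a, b]) (h p x)%:E =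
   (p.[a] * gauss_kernel a - p.[b] * gauss_kernel b)%:E)%E.
Proof.
move=> ab; have cF : continuous (fun y => - (p.[y] * gauss_kernel y)).
  by move=> x; apply/differentiable_continuous/derivable1_diffP/ex_derive.
rewrite (@continuous_FTC2 _ _ (fun y => - (p.[y] * gauss_kernel y)))//.
- by rewrite -EFinB opprK addrC.
- exact: continuous_subspaceT.
- split=> //.
  + by apply/cvg_at_right_filter/cF.
  + by apply/cvg_at_left_filter/cF.
- by move=> x _; rewrite derive1E; apply: derive_val.
Qed.

(** The sign [e] selects the end of the line. Bounding p by C exp(x^2/4) leaves C exp(- N^2/4) with
    N = n + 1, and exp(N^2/4) >= 1 + N^2/4 >= N/4. *)
Lemma cvg_horner_gauss_kernel (p : {poly R}) (e : R) : `|e| = 1 ->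
  p.[e * n.+1%:R] * gauss_kernel (e * n.+1%:R) @[n --> \oo] --> 0.
Proof.
move=> e1; have [C C0 pC] := poly_growth_expR_bound (poly_growth_horner p).
apply: norm_cvg0.
apply: (@squeeze_cvgr _ _ _ _ (cst 0) (fun n => C * (4 / n.+1%:R))).
- near=> n; rewrite normr_ge0/= normrM (ger0_norm (expR_ge0 _)).
  have E : (e * n.+1%:R) ^+ 2 = n.+1%:R ^+ 2 :> R.
    by rewrite exprMn -(real_normK (num_real e)) e1 expr1n mul1r.
  apply: (le_trans (ler_wpM2r (expR_ge0 _) (pC _))).
  rewrite /gauss_kernel E -(mulrA C) -expRD.
  rewrite (_ : _ + _ = - (n.+1%:R ^+ 2 / 4)); last first.
    by field.
  apply: ler_wpM2l => //; rewrite expRN -[leRHS]invf_div.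
  rewrite lef_pV2 ?posrE ?expR_gt0 ?divr_gt0//.
  apply: le_trans (expR_ge1Dx _); rewrite ler_wpDl// ler_wpM2r// ?invr_ge0//.
  by rewrite expr2 ler_peMl// ler1n.
- exact: cvg_cst.
- rewrite -[X in _ --> X](mulr0 C) -[X in C * X](mulr0 4).
  apply: cvgM; first exact: cvg_cst.
  by apply: cvgM; [exact: cvg_cst|exact: cvg_harmonic].
Unshelve. all: by end_near. Qed.

(** Integration by parts: on [-N, N] the integral of [h p] consists of boundary terms that vanish as
    N grows, and dominated convergence, with [h p] itself as the bound, passes to the whole line. *)
Lemma gauss_mean_stein (p : {poly R}) :
  gauss_mean (fun x => x * p.[x]) = gauss_mean (fun x => p^`().[x]).
Proof.
pose q := 'X * p - p^`().
have xpE : (fun x : R => x * p.[x]) = horner ('X * p).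
  by apply/funext => x; rewrite hornerM hornerX.
apply/eqP; rewrite -subr_eq0 /gauss_mean -RintegralB//; last 2 first.
- by rewrite xpE; exact: integrable_horner.
- exact: integrable_horner.
have qE x : x * p.[x] - p^`().[x] = q.[x].
  by rewrite /q hornerD hornerN hornerM hornerX.
under eq_Rintegral do rewrite qE.
have mq : measurable_fun [set: M] (fun x : M => (q.[x])%:E).
  by apply/measurable_EFinP; exact: measurable_poly.
have ih : leb.-integrable [set: M] (fun x => (h p x)%:E).
  have /integrable_normal_prob_density := integrable_horner q.
  move=> /(_ mq) /(integrableZl measurableT (normal_peak 1)^-1).
  apply: eq_integrable => // x _ /=.
  rewrite -!EFinM std_normal_pdfE mulrCA mulKf//.
  by rewrite gt_eqF// normal_peak_gt0 ?oner_eq0.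
suff ih0 : (\int[leb]_x (h p x)%:E = 0)%E.
  rewrite /Rintegral integral_normal_prob_density//.
  under eq_integral do rewrite -EFinM std_normal_pdfE mulrCA EFinM.
  by rewrite integralZl// ih0 mule0.
pose hn n x := ((h p \_ `[- n.+1%:R, n.+1%:R]) x)%:E.
have hnE n : (\int[leb]_x hn n x = (p.[-1 * n.+1%:R] * gauss_kernel (-1 * n.+1%:R)
    - p.[1 * n.+1%:R] * gauss_kernel (1 * n.+1%:R))%:E)%E.
  rewrite !mulN1r !mul1r -integral_segment ?gtrN// [RHS]integral_mkcond.
  by apply: eq_integral => x _; rewrite /hn restrict_EFin.
have mh : measurable_fun [set: R] (h p) by exact: continuous_measurable_fun.
have mhn n : measurable_fun [set: M] (hn n).
  have mI : measurable (`[- n.+1%:R, n.+1%:R]%classic : set M) by [].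
  by apply/measurable_EFinP/(measurable_restrictT _ mI); exact: measurable_funTS.
have hn_cvg x : hn n x @[n --> \oo] --> (h p x)%:E.
  apply: cvg_near_cst; near=> n; rewrite /hn patchE mem_set//=.
  rewrite in_itv/= -ler_norml.
  apply: (@le_trans _ _ n%:R); last by rewrite ler_nat.
  by near: n; exact: nbhs_infty_ger.
have hn_le x n : (`|hn n x| <= `|(h p x)%:E|)%E.
  by rewrite /hn patchE; case: ifPn => _ //; rewrite abse0 abse_ge0.
have hn_ae : {ae leb, forall x, [set: M] x -> hn n x @[n --> \oo] --> (h p x)%:E}.
  by apply: aeW => x _; exact: hn_cvg.
have hn_ae_le : {ae leb, forall x n, [set: M] x ->
    (`|hn n x| <= `|(h p x)%:E|)%E}.
  by apply: aeW => x n _; exact: hn_le.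
have [_ _ cvg_hn] := dominated_convergence measurableT mhn (measurable_int _ ih)
  hn_ae (integrable_abse ih) hn_ae_le.
have cvg0 : (\int[leb]_x hn n x)%E @[n --> \oo] --> 0%E.
  under eq_fun do rewrite hnE.
  apply: cvg_EFin; first by near=> n.
  rewrite -[X in _ --> X](subrr 0); apply: cvgB;
    apply: cvg_horner_gauss_kernel; by rewrite ?normrN normr1.
by rewrite -(cvg_lim _ cvg_hn)// (cvg_lim _ cvg0).
Unshelve. all: by end_near. Qed.

End stein.

(** * Hermite polynomials *)

Section hermite.
Context {R : realType}.
Local Notation M := (measurableTypeR R).
Local Notation gam := (normal_prob (0 : R) (1 : R)).
Implicit Types (p q : {poly R}) (c x : R).

Lemma gauss_mean_hornerD p q :
  gauss_mean (horner (p + q)) = gauss_mean (horner p) + gauss_mean (horner q).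
Proof.
rewrite /gauss_mean -RintegralD//; [|exact: integrable_horner..].
by apply: eq_Rintegral => x _; rewrite hornerD.
Qed.

Lemma gauss_mean_hornerZ c p : gauss_mean (horner (c *: p)) = c * gauss_mean (horner p).
Proof.
rewrite /gauss_mean -RintegralZl//; last exact: integrable_horner.
by apply: eq_Rintegral => x _; rewrite hornerZ.
Qed.

Lemma gauss_mean_hornerB p q :
  gauss_mean (horner (p - q)) = gauss_mean (horner p) - gauss_mean (horner q).
Proof. by rewrite gauss_mean_hornerD -scaleN1r gauss_mean_hornerZ mulN1r. Qed.

Lemma gauss_mean_hornerC c : gauss_mean (horner c%:P) = c.
Proof.
rewrite /gauss_mean /Rintegral; under eq_integral do rewrite hornerC.
by rewrite (integral_probability_cst gam).
Qed.

Fixpoint hermite_poly (k : nat) : {poly R} :=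
  if k is k'.+1 then 'X * hermite_poly k' - (hermite_poly k')^`() else 1.

Lemma derive1n_gauss_kernel k : derive1n k gauss_kernel =
  (fun x => (-1) ^+ k * (hermite_poly k).[x] * gauss_kernel x).
Proof.
elim: k => [|k IH].
  by apply/funext => x; rewrite derive1n0 hornerC expr0 !mul1r.
apply/funext => x; rewrite derive1nS IH derive1E.
have d : is_derive x (1 : R)
    (fun y => (-1) ^+ k * (hermite_poly k).[y] * gauss_kernel y)
    ((-1) ^+ k.+1 * (hermite_poly k.+1).[x] * gauss_kernel x).
  apply: is_derive_eq; rewrite /GRing.scale/= hornerD hornerN hornerM hornerX exprS.
  by ring.
exact: derive_val.
Qed.

Lemma hermiteE k x : hermite k x = (Num.sqrt k`!%:R)^-1 * (hermite_poly k).[x].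
Proof.
rewrite /hermite -/gauss_kernel derive1n_gauss_kernel.
have e1 : expR (x ^+ 2 / 2) * gauss_kernel x = 1 by exact: expRxMexpNx_1.
have s1 : (-1) ^+ k * (-1) ^+ k = 1 :> R by rewrite -exprMn mulrNN mulr1 expr1n.
transitivity ((Num.sqrt k`!%:R)^-1 * (hermite_poly k).[x] *
  ((-1) ^+ k * (-1) ^+ k) * (expR (x ^+ 2 / 2) * gauss_kernel x)); first by ring.
by rewrite e1 s1 !mulr1.
Qed.

(** By Stein's identity, ['X - d/dx] is the adjoint of [d/dx] for the Gaussian measure, and
    [hermite_poly k] is its k-th iterate on 1. *)
Lemma gauss_mean_hermite_poly_mul k q :
  gauss_mean (horner (hermite_poly k * q)) = gauss_mean (horner q^`(k)).
Proof.
elim: k q => [q|k IH q]; first by rewrite mul1r.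
rewrite derivSn -IH /= mulrBl gauss_mean_hornerB.
have -> : gauss_mean (horner ('X * hermite_poly k * q)) =
    gauss_mean (horner (hermite_poly k * q)^`()).
  rewrite -gauss_mean_stein; congr gauss_mean; apply/funext => x.
  by rewrite -mulrA hornerM hornerX.
by rewrite derivM gauss_mean_hornerD addrAC subrr add0r.
Qed.

Lemma size_lead_hermite_poly k :
  size (hermite_poly k) = k.+1 /\ lead_coef (hermite_poly k) = 1.
Proof.
elim: k => [|k [sk lk]]; first by rewrite size_poly1 lead_coef1.
have k0 : hermite_poly k != 0 by rewrite -size_poly_gt0 sk.
have sX : size ('X * hermite_poly k) = k.+2 by rewrite mulrC size_mulX// sk.
have lt : (size (- (hermite_poly k)^`())%R < size ('X * hermite_poly k)%R)%N.
  by rewrite size_polyN sX -sk (leq_trans (lt_size_deriv k0)).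
by rewrite /= size_polyDl// lead_coefDl// sX mulrC lead_coefMX.
Qed.

(** The k-th derivative kills a polynomial of degree j < k and sends a monic one of degree k to
    k!. *)
Lemma gauss_mean_hermite_poly_orth j k : (j <= k)%N ->
  gauss_mean (horner (hermite_poly k * hermite_poly j)) =
  if j == k then k`!%:R else 0.
Proof.
move=> jk; rewrite gauss_mean_hermite_poly_mul.
have [sj lj] := size_lead_hermite_poly j.
case: eqP => [->|/eqP njk]; last first.
  have jlk : (j < k)%N by rewrite ltn_neqAle njk.
  by rewrite derivn_poly0 ?sj// -(gauss_mean_hornerC 0) polyC0.
have [sk lk] := size_lead_hermite_poly k.
have -> : (hermite_poly k)^`(k) = (k`!%:R)%:P.
  apply/polyP => i; rewrite coef_derivn coefC; case: i => [|i].
    rewrite addn0 ffactnn; have := lk; rewrite lead_coefE sk/= => ->.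
    by [].
  by rewrite nth_default ?sk ?mul0rn// addnS ltnS leq_addr.
by rewrite gauss_mean_hornerC.
Qed.

Lemma gauss_mean_hermite_orth j k :
  gauss_mean (fun x => hermite j x * hermite k x) = (j == k)%:R.
Proof.
wlog jk : j k / (j <= k)%N.
  move=> W; have [/W//|/ltnW kj] := leqP j k.
  rewrite eq_sym -W//; congr gauss_mean; apply/funext => x; exact: mulrC.
have -> : (fun x => hermite j x * hermite k x) = horner
    (((Num.sqrt j`!%:R)^-1 * (Num.sqrt k`!%:R)^-1) *:
      (hermite_poly k * hermite_poly j)).
  by apply/funext => x; rewrite !hermiteE hornerZ hornerM; ring.
rewrite gauss_mean_hornerZ gauss_mean_hermite_poly_orth//.
case: eqP => [->|_]; last by rewrite mulr0.
by rewrite -invfM -expr2 sqr_sqrtr// mulVf// pnatr_eq0 -lt0n fact_gt0.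
Qed.

(** The Appell property; it turns the defining recursion into the three-term recurrence H_(k+2) = X
    H_(k+1) - (k+1) H_k. *)
Lemma deriv_hermite_poly k : (hermite_poly k.+1)^`() = k.+1%:R *: hermite_poly k.
Proof.
elim: k => [|k IH].
  rewrite /= mulr1 derivB derivX scale1r.
  by rewrite -[X in X^`()^`()]/(1%:P) derivC deriv0 subr0.
rewrite [hermite_poly k.+2]/= -/(hermite_poly k.+1) derivB derivM derivX mul1r.
rewrite IH derivZ -scalerAr -addrA -scalerBr -/(hermite_poly k.+1).
by rewrite -[in RHS]natr1 scalerDl scale1r addrC.
Qed.

(** Hermite polynomials are the eigenfunctions of the Ornstein-Uhlenbeck semigroup. In the
    three-term recurrence, Stein's identity in z turns the term r z H_(j+1) into r^2 (j+1) H_j, and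
    r^2 - 1 = - rho^2; the means thus obey the recurrence of rho^j H_j(x). Being of order two, it is
    solved for consecutive indices together. *)
Lemma gauss_mean_hermite_poly_affine k rho r x : rho ^+ 2 + r ^+ 2 = 1 ->
  gauss_mean (fun z => (hermite_poly k).[rho * x + r * z]) =
  rho ^+ k * (hermite_poly k).[x].
Proof.
move=> rr1; pose L := r *: 'X + (rho * x)%:P.
pose A k := gauss_mean (horner (hermite_poly k \Po L)).
have LE z : L.[z] = rho * x + r * z by rewrite hornerD hornerZ hornerX hornerC addrC.
have AE j : gauss_mean (fun z => (hermite_poly j).[rho * x + r * z]) = A j.
  by congr gauss_mean; apply/funext => z; rewrite horner_comp LE.
have A0 : A 0%N = 1 by rewrite /A /= comp_polyC gauss_mean_hornerC.
have recA j : A j.+2 = rho * x * A j.+1 - rho ^+ 2 * j.+1%:R * A j.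
  rewrite /A [hermite_poly j.+2]/= -/(hermite_poly j.+1).
  rewrite comp_polyB comp_polyM comp_polyX.
  rewrite gauss_mean_hornerB deriv_hermite_poly comp_polyZ gauss_mean_hornerZ.
  rewrite {1}/L mulrDl gauss_mean_hornerD mul_polyC gauss_mean_hornerZ -scalerAl.
  rewrite gauss_mean_hornerZ.
  have -> : gauss_mean (horner ('X * (hermite_poly j.+1 \Po L))) =
      gauss_mean (horner (hermite_poly j.+1 \Po L)^`()).
    rewrite -gauss_mean_stein; congr gauss_mean; apply/funext => z.
    by rewrite hornerM hornerX.
  rewrite deriv_comp deriv_hermite_poly.
  have -> : L^`() = r%:P by rewrite derivD derivZ derivX derivC addr0 alg_polyC.
  rewrite comp_polyZ -scalerAl [_ * r%:P]mulrC mul_polyC !gauss_mean_hornerZ.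
  have r2 : r ^+ 2 = 1 - rho ^+ 2 by rewrite -rr1 addrC addKr.
  by ring: r2.
rewrite AE; suff : A k = rho ^+ k * (hermite_poly k).[x] /\
    A k.+1 = rho ^+ k.+1 * (hermite_poly k.+1).[x] by case.
elim: k => [|k [IH1 IH2]].
  split; first by rewrite A0 hornerC mul1r.
  have gX : gauss_mean (horner ('X : {poly R})) = 0.
    have := gauss_mean_stein (1%:P : {poly R}); rewrite derivC.
    rewrite (gauss_mean_hornerC 0) => <-; congr gauss_mean; apply/funext => z.
    by rewrite hornerX hornerC mulr1.
  rewrite /A /= mulr1 derivC subr0 comp_polyX /L gauss_mean_hornerD.
  by rewrite gauss_mean_hornerZ gX mulr0 add0r gauss_mean_hornerC hornerX expr1.
split=> //; rewrite recA IH1 IH2 [hermite_poly k.+2]/= -/(hermite_poly k.+1).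
rewrite deriv_hermite_poly; move: (hermite_poly k.+1) (hermite_poly k) => P Q.
by rewrite hornerD hornerN hornerM hornerX hornerZ !exprS; ring.
Qed.

End hermite.

(** * Cauchy-Schwarz and Bessel in L2 *)

Section l2.
Context d (T : measurableType d) (R : realType) (mu : {measure set T -> \bar R}).
Local Notation itg f := (mu.-integrable [set: T] (EFin \o f)).
Implicit Types f g h : T -> R.

Definition sq_integrable f :=
  measurable_fun [set: T] f /\ itg (fun x => f x ^+ 2).

Definition dot f g := \int[mu]_x (f x * g x).

Lemma sq_integrable_mul f g : sq_integrable f -> sq_integrable g ->
  itg (fun x => f x * g x).
Proof.
move=> [mf f2] [mg g2].
apply: (le_integrable measurableT _ _ (integrableD measurableT f2 g2)).
  exact/measurable_EFinP/measurable_funM.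
move=> x _ /=; rewrite lee_fin normrM (ger0_norm (addr_ge0 (sqr_ge0 _) (sqr_ge0 _))).
rewrite -(real_normK (num_real (f x))) -(real_normK (num_real (g x))).
have := sqr_ge0 (`|f x| - `|g x|).
by have := normr_ge0 (f x); have := normr_ge0 (g x); nra.
Qed.

Lemma sq_integrableZ c f : sq_integrable f -> sq_integrable (fun x => c * f x).
Proof.
move=> [mf f2]; split; first exact: measurable_funM.
have := integrableZl measurableT (c ^+ 2) f2; apply: eq_integrable => // x _ /=.
by rewrite -EFinM exprMn.
Qed.

Lemma sq_integrableD f g : sq_integrable f -> sq_integrable g ->
  sq_integrable (fun x => f x + g x).
Proof.
move=> Lf Lg; have fg := sq_integrable_mul Lf Lg.
case: Lf Lg => [mf f2] [mg g2]; split; first exact: measurable_funD.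
have := integrableD measurableT (integrableD measurableT f2 g2)
  (integrableZl measurableT 2 fg).
apply: eq_integrable => // x _ /=; rewrite -EFinM -!EFinD; congr EFin; ring.
Qed.

Lemma dotC f g : dot f g = dot g f.
Proof. by apply: eq_Rintegral => x _; rewrite mulrC. Qed.

Lemma dotDl f g h : sq_integrable f -> sq_integrable g -> sq_integrable h ->
  dot (fun x => f x + g x) h = dot f h + dot g h.
Proof.
move=> Lf Lg Lh; rewrite /dot -RintegralD//; try exact: sq_integrable_mul.
by apply: eq_Rintegral => x _; rewrite mulrDl.
Qed.

Lemma dotZl c f g : sq_integrable f -> sq_integrable g ->
  dot (fun x => c * f x) g = c * dot f g.
Proof.
move=> Lf Lg; rewrite /dot -RintegralZl//; last exact: sq_integrable_mul.
by apply: eq_Rintegral => x _; rewrite mulrA.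
Qed.

Lemma dot_ge0 f : 0 <= dot f f.
Proof. by apply: Rintegral_ge0 => x _; rewrite -expr2 sqr_ge0. Qed.

Lemma cauchy_schwarz f g : sq_integrable f -> sq_integrable g ->
  dot f g ^+ 2 <= dot f f * dot g g.
Proof.
move=> Lf Lg.
have P t : 0 <= dot f f + 2 * t * dot f g + t ^+ 2 * dot g g.
  have Ltg := sq_integrableZ t Lg; have Lftg := sq_integrableD Lf Ltg.
  have := dot_ge0 (fun x => f x + t * g x).
  rewrite dotDl// dotZl// (dotC f) dotDl// dotZl//.
  rewrite (dotC g (fun x => f x + t * g x)) dotDl// dotZl// (dotC g f).
  by congr (0 <= _); ring.
have [g0|g0] := eqVneq (dot g g) 0.
  rewrite g0 mulr0; suff -> : dot f g = 0 by rewrite expr0n.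
  (* Without its quadratic term the polynomial in t is affine; at this t it equals -1. *)
  apply/eqP/negPn/negP => fg0; have := P (- (dot f f + 1) / (2 * dot f g)).
  rewrite g0 mulr0 addr0 (_ : _ + _ = -1); first by rewrite oppr_ge0 ler10.
  by field.
have gp : 0 < dot g g by rewrite lt_neqAle eq_sym g0 dot_ge0.
(* The minimizer of the quadratic. *)
have := P (- dot f g / dot g g).
rewrite (_ : _ + _ = (dot f f * dot g g - dot f g ^+ 2) / dot g g); last by field.
by rewrite pmulr_lge0 ?invr_gt0// subr_ge0.
Qed.

Section bessel.
Variables (e : nat -> T -> R) (m : T -> R) (c : nat -> R).
Hypothesis (Le : forall k, sq_integrable (e k)) (Lm : sq_integrable m).
Hypothesis e_orth : forall j k, dot (e j) (e k) = (j == k)%:R.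
Hypothesis me : forall k, dot m (e k) = c k.

Let remainder n x := m x + \sum_(k < n) - c k * e k x.

Let remainderS n : remainder n.+1 = (fun x => remainder n x + - c n * e n x).
Proof. by apply/funext => x; rewrite /remainder big_ord_recr/= addrA. Qed.

Let remainder0 : remainder 0 = m.
Proof. by apply/funext => x; rewrite /remainder big_ord0 addr0. Qed.

Let L2_remainder n : sq_integrable (remainder n).
Proof.
elim: n => [|n IH]; rewrite ?remainder0// remainderS.
by apply: sq_integrableD => //; exact: sq_integrableZ.
Qed.

Let dot_remainder n f : sq_integrable f ->
  dot (remainder n) f = dot m f - \sum_(k < n) c k * dot (e k) f.
Proof.
move=> Lf; elim: n => [|n IH]; first by rewrite remainder0 big_ord0 subr0.
rewrite remainderS dotDl//; last exact: sq_integrableZ.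
by rewrite dotZl// IH big_ord_recr/= mulNr opprD addrA.
Qed.

Let dot_remainder_orth n k : (n <= k)%N -> dot (remainder n) (e k) = c k.
Proof.
move=> nk; rewrite dot_remainder// me big1 ?subr0// => j _.
by rewrite e_orth ltn_eqF ?mulr0// (leq_trans (ltn_ord j)).
Qed.

Let dot_remainder_self n :
  dot (remainder n) (remainder n) = dot m m - \sum_(k < n) c k ^+ 2.
Proof.
elim: n => [|n IH]; first by rewrite remainder0 big_ord0 subr0.
have Lce := sq_integrableZ (- c n) (Le n).
rewrite remainderS dotDl//; last exact: sq_integrableD.
rewrite dotZl//; last exact: sq_integrableD.
rewrite dotC dotDl// dotZl// IH dotC dot_remainder_orth//.
rewrite (dotC (e n)) dotDl// dotZl// dot_remainder_orth// e_orth eqxx big_ord_recr/=.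
by ring.
Qed.

(* Cauchy-Schwarz for [f] against the part of [m] orthogonal to the first [e k]. *)
Lemma bessel_remainder n f : sq_integrable f ->
  (dot m f - \sum_(k < n) c k * dot (e k) f) ^+ 2 <=
  (dot m m - \sum_(k < n) c k ^+ 2) * dot f f.
Proof.
move=> Lf; rewrite -dot_remainder// -dot_remainder_self.
exact: cauchy_schwarz.
Qed.

End bessel.
End l2.

(** * The Mehler kernel *)

Section mehler.
Context {R : realType}.
Local Notation leb := (@lebesgue_measure R).
Local Notation M := (measurableTypeR R).
Local Notation gam := (normal_prob (0 : R) (1 : R)).

Lemma normal_peak_scale (s : R) : 0 < s -> normal_peak s = s^-1 * normal_peak 1.
Proof.
move=> s0; rewrite /normal_peak expr1n mul1r -mulrnAr sqrtrM ?sqr_ge0//.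
by rewrite sqrtr_sqr gtr0_norm// invfM.
Qed.

Variables rho r : R.
Hypotheses (r0 : 0 < r) (rr1 : rho ^+ 2 + r ^+ 2 = 1).

(* Density, with respect to the product of its marginals, of the law of a
   standard Gaussian pair of correlation [rho]. *)
Definition mehler (z : M * M) : R :=
  r^-1 * expR (z.2 ^+ 2 / 2 - (z.2 - rho * z.1) ^+ 2 / (2 * r ^+ 2)).

Lemma mehler_ge0 z : 0 <= mehler z.
Proof. by rewrite mulr_ge0 ?expR_ge0// invr_ge0 ltW. Qed.

Lemma measurable_mehler : measurable_fun [set: M * M] mehler.
Proof.
apply: measurable_funM => //; apply: measurableT_comp => //.
apply: measurable_funB.
  by apply: measurable_funM => //; exact: measurable_funX.
apply: measurable_funM => //; apply: measurable_funX.
by apply: measurable_funB => //; exact: measurable_funM.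
Qed.

(** Conditionally on the first variable x, the second one is N(rho x, r^2). *)
Lemma mehler_normal_pdf x y :
  mehler (x, y) * normal_pdf 0 1 y = normal_pdf (rho * x) r y.
Proof.
rewrite std_normal_pdfE normal_pdfE ?gt_eqF// (normal_peak_scale r0).
rewrite /normal_fun /mehler/=.
by rewrite mulrACA -expRD; congr (_ * expR _); field; rewrite gt_eqF.
Qed.

Lemma measurable_correlated : measurable_fun [set: M * M]
  (fun z : M * M => (z.1, rho * z.1 + r * z.2) : M * M).
Proof. by apply/measurable_fun_pair => //; exact: measurable_linear_comb. Qed.

Local Open Scope ereal_scope.

Let ge0_integral_mehler (F : M * M -> \bar R) :
  measurable_fun [set: M * M] F -> (forall z, 0 <= F z) ->
  \int[gam \x gam]_z (F z * (mehler z)%:E) =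
  \int[gam \x gam]_z F (z.1, rho * z.1 + r * z.2)%R.
Proof.
move=> mF F0; have mFc := measurableT_comp mF measurable_correlated.
have mFm : measurable_fun [set: M * M] (fun z => F z * (mehler z)%:E).
  by apply: emeasurable_funM => //; apply/measurable_EFinP; exact: measurable_mehler.
have Fm0 z : 0 <= F z * (mehler z)%:E by rewrite mule_ge0// lee_fin mehler_ge0.
rewrite (fubini_tonelli1 (m1 := gam) (m2 := gam) _ mFm Fm0).
rewrite (fubini_tonelli1 (m1 := gam) (m2 := gam) _ mFc (fun=> F0 _)).
apply: eq_integral => x _; rewrite /fubini_F/=.
have mFx : measurable_fun [set: M] (fun y => F (x, y)) by exact: measurableT_comp.
rewrite (integral_std_normal_affine (rho * x) r0 mFx (fun=> F0 _)).
rewrite (integral_normal_prob _ _ mFx (fun=> F0 _)).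
have mFmx : measurable_fun [set: M] (fun y => F (x, y) * (mehler (x, y))%:E).
  by apply: (measurableT_comp mFm).
rewrite (integral_normal_prob _ _ mFmx (fun=> Fm0 _)).
by apply: eq_integral => y _; rewrite -muleA -EFinM mehler_normal_pdf.
Qed.

Lemma integral_mehler (F : M * M -> \bar R) : measurable_fun [set: M * M] F ->
  \int[gam \x gam]_z (F z * (mehler z)%:E) =
  \int[gam \x gam]_z F (z.1, rho * z.1 + r * z.2)%R.
Proof.
move=> mF; rewrite integralE [RHS]integralE.
rewrite (funepos_mulr_ge0 _ mehler_ge0) (funeneg_mulr_ge0 _ mehler_ge0).
congr (_ - _).
  rewrite (ge0_integral_mehler (measurable_funepos mF) (funepos_ge0 F)).
  by apply: eq_integral => z _; rewrite !funeposE.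
rewrite (ge0_integral_mehler (measurable_funeneg mF) (funeneg_ge0 F)).
by apply: eq_integral => z _; rewrite !funenegE.
Qed.

(* Completing squares, the integrand times the Gaussian weights is [r ^- 2]
   times an N(0, a) density in [x] and, given [x], an N(_, a^-1) density in
   [y], where [a = (1 + rho ^+ 2) / r ^+ 2]. *)
Lemma integral_mehler_sqr :
  \int[gam \x gam]_z (mehler z ^+ 2)%:E = (r ^- 2)%:E.
Proof.
have mm2 : measurable_fun [set: M * M] (fun z => (mehler z ^+ 2)%:E).
  by apply/measurable_EFinP/measurable_funX; exact: measurable_mehler.
have m20 z : 0 <= (mehler z ^+ 2)%:E by rewrite lee_fin sqr_ge0.
rewrite (integral_gauss2 mm2 m20).
pose u : R := Num.sqrt (1 + rho ^+ 2); have u0 : (0 < u)%R.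
  by rewrite sqrtr_gt0 ltr_pwDl// sqr_ge0.
have u2 : (u ^+ 2 = 1 + rho ^+ 2)%R by rewrite sqr_sqrtr// addr_ge0// sqr_ge0.
pose s : R := (u / r)%R; have s0 : (0 < s)%R by rewrite divr_gt0.
pose mn x : R := (2 * rho / u ^+ 2 * x)%R.
have step x y : (mehler (x, y) ^+ 2 * (normal_pdf 0 1 x * normal_pdf 0 1 y) =
    r ^- 2 * normal_pdf 0 s x * normal_pdf (mn x) s^-1 y)%R.
  have si0 : (0 < s^-1)%R by rewrite invr_gt0.
  rewrite !std_normal_pdfE !normal_pdfE ?gt_eqF//.
  rewrite (normal_peak_scale s0) (normal_peak_scale si0) /normal_fun /mehler/=.
  rewrite exprMn exprVn -expRM_natl.
  have s2 : (s ^+ 2 = (1 + rho ^+ 2) / r ^+ 2)%R by rewrite /s expr_div_n u2.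
  have r2 : (r ^+ 2 = 1 - rho ^+ 2)%R by rewrite -rr1 addrAC subrr add0r.
  have expE : (2 * (y ^+ 2 / 2 - (y - rho * x) ^+ 2 / (2 * r ^+ 2)) +
      (- (x ^+ 2 / 2) + - (y ^+ 2 / 2)) = - (x - 0) ^+ 2 / (s ^+ 2 *+ 2) +
      - (y - mn x) ^+ 2 / (s^-1 ^+ 2 *+ 2))%R.
    rewrite exprVn s2 /mn u2 r2; field.
    rewrite -u2 -r2 !gt_eqF ?exprn_gt0//.
  transitivity (r ^- 2 * normal_peak 1 ^+ 2 * expR (2 * (y ^+ 2 / 2 -
      (y - rho * x) ^+ 2 / (2 * r ^+ 2)) + (- (x ^+ 2 / 2) + - (y ^+ 2 / 2))))%R.
    by rewrite !expRD; ring.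
  by rewrite expE expRD invrK; field; rewrite !gt_eqF.
transitivity (\int[leb]_x ((r ^- 2)%:E * (normal_pdf 0 s x)%:E)).
  apply: eq_integral => x _.
  transitivity (\int[leb]_y
      ((r ^- 2 * normal_pdf 0 s x)%:E * (normal_pdf (mn x) s^-1 y)%:E)).
    by apply: eq_integral => y _; rewrite -EFinM step EFinM.
  rewrite integralZl//; last exact: integrable_normal_pdf.
  by rewrite integral_normal_pdf mule1 EFinM.
rewrite integralZl//; last exact: integrable_normal_pdf.
by rewrite integral_normal_pdf mule1.
Qed.

End mehler.

(** * Products of functions of independent Gaussians *)

Section correlation.
Context {R : realType}.
Local Notation M := (measurableTypeR R).
Local Notation gam := (normal_prob (0 : R) (1 : R)).
Local Notation itg f := (gam.-integrable [set: M] (EFin \o f)).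
Local Notation itg2 f := ((gam \x gam)%E.-integrable [set: M * M] (EFin \o f)).

Lemma integrable_prod_mul (f g : M -> R) : itg f -> itg g ->
  itg2 (fun z => f z.1 * g z.2).
Proof.
move=> fi gi; have /integrableP[/measurable_EFinP mf flt] := fi.
have /integrableP[/measurable_EFinP mg glt] := gi.
have mfg : measurable_fun [set: M * M] (fun z : M * M => f z.1 * g z.2).
  by apply: measurable_funM; apply: measurableT_comp.
apply/(integrable12ltyP gam gam); first exact/measurable_EFinP.
have gE : (\int[gam]_y `|(g y)%:E| \is a fin_num)%E.
  by rewrite ge0_fin_numE// integral_ge0.
rewrite (_ : (\int[gam]_x _ = (\int[gam]_y `|(g y)%:E|) * \int[gam]_x `|(f x)%:E|)%E).
  by rewrite lte_mul_pinfty// integral_ge0.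
rewrite -ge0_integralZl//; last 2 first.
- by apply: measurableT_comp => //; exact/measurable_EFinP.
- exact: integral_ge0.
apply: eq_integral => x _; rewrite muleC -ge0_integralZl//; last first.
- by apply: measurableT_comp => //; exact/measurable_EFinP.
by apply: eq_integral => y _; rewrite -abseM -EFinM.
Qed.

Lemma Rintegral_prod_mul (f g : M -> R) : itg f -> itg g ->
  \int[(gam \x gam)%E]_z (f z.1 * g z.2) = gauss_mean f * gauss_mean g.
Proof.
move=> fi gi; rewrite /Rintegral -(integral12_prod_meas1 (integrable_prod_mul fi gi)).
rewrite /= /gauss_mean /Rintegral -fineM; last 2 first.
- exact: integrable_fin_num.
- exact: integrable_fin_num.
congr fine; rewrite muleC -(fineK (integrable_fin_num measurableT gi)) -integralZl//.
apply: eq_integral => x _; rewrite /fubini_F/=.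
under eq_integral do rewrite EFinM.
by rewrite integralZl// muleC fineK// integrable_fin_num.
Qed.

End correlation.

(** * Hermite expansion of correlated means *)

Section correlation.
Context {R : realType}.
Local Notation M := (measurableTypeR R).
Local Notation gam := (normal_prob (0 : R) (1 : R)).
Local Notation gam2 := (gam \x gam)%E.

Definition tensor (f g : M -> R) (z : M * M) := f z.1 * g z.2.

Lemma sq_integrable_tensor f g : sq_integrable gam f -> sq_integrable gam g ->
  sq_integrable gam2 (tensor f g).
Proof.
move=> [mf f2] [mg g2]; split.
  by apply: measurable_funM; apply: measurableT_comp.
have := integrable_prod_mul f2 g2.
by apply: eq_integrable => // z _ /=; rewrite exprMn.
Qed.

Lemma dot_tensor (f f' g g' : M -> R) :
  sq_integrable gam f -> sq_integrable gam f' ->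
  sq_integrable gam g -> sq_integrable gam g' ->
  dot gam2 (tensor f g) (tensor f' g') = dot gam f f' * dot gam g g'.
Proof.
move=> Lf Lf' Lg Lg'.
transitivity
  (gauss_mean (fun x => f x * f' x) * gauss_mean (fun x => g x * g' x)) => //.
rewrite -Rintegral_prod_mul; [|exact: sq_integrable_mul..].
by apply: eq_Rintegral => z _; rewrite mulrACA.
Qed.

Lemma sq_integrable_hermite k : sq_integrable gam (hermite k).
Proof.
have -> : hermite k = horner ((Num.sqrt k`!%:R)^-1 *: hermite_poly k) :> (R -> R).
  by apply/funext => x; rewrite hermiteE hornerZ.
set p := _ *: _; split; first exact: measurable_poly.
have := integrable_horner (p ^+ 2); apply: eq_integrable => // x _ /=.
by rewrite horner_exp.
Qed.

Section fixed_correlation.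
Variables rho r : R.
Hypotheses (r0 : 0 < r) (rr1 : rho ^+ 2 + r ^+ 2 = 1).
Local Notation mehler := (mehler rho r).

Lemma sq_integrable_mehler : sq_integrable gam2 mehler.
Proof.
split; first exact: measurable_mehler.
apply/integrableP; split.
  by apply/measurable_EFinP/measurable_funX; exact: measurable_mehler.
rewrite (eq_integral (fun z => (mehler z ^+ 2)%:E)).
  by rewrite (integral_mehler_sqr r0 rr1) ltry.
by move=> z _; rewrite /= ger0_norm ?sqr_ge0.
Qed.

Lemma dot_mehler_mehler : dot gam2 mehler mehler = r ^- 2.
Proof.
rewrite /dot /Rintegral (eq_integral (fun z => (mehler z ^+ 2)%:E)).
  by rewrite (integral_mehler_sqr r0 rr1).
by move=> z _; rewrite expr2.
Qed.

Lemma dot_mehler (F : M * M -> R) : measurable_fun [set: M * M] F ->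
  dot gam2 mehler F = \int[gam2]_z F (z.1, rho * z.1 + r * z.2).
Proof.
move=> mF; congr fine.
rewrite -(@integral_mehler _ _ _ r0 (EFin \o F)); last exact/measurable_EFinP.
by apply: eq_integral => z _; rewrite EFinM muleC.
Qed.

(** Transferred to the product measure, the integrand becomes [F * mehler], a product of two
    square-integrable functions. *)
Lemma integrable_correlated (F : M * M -> R) : sq_integrable gam2 F ->
  gam2.-integrable [set: M * M]
    (fun z : M * M => (F (z.1, rho * z.1 + r * z.2))%:E).
Proof.
move=> LF; have mF := LF.1.
have /integrableP[_] := sq_integrable_mul LF sq_integrable_mehler.
move=> Flt; apply/integrableP; split.
  apply/measurable_EFinP.
  exact: (measurableT_comp mF (measurable_correlated rho r)).
rewrite -(@integral_mehler _ _ _ r0 (fun z => `|(F z)%:E|)%E); last first.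
  by apply: measurableT_comp => //; exact/measurable_EFinP.
apply: le_lt_trans Flt; rewrite le_eqVlt; apply/orP; left; apply/eqP.
apply: eq_integral => z _; rewrite /= normrM -EFinM.
by rewrite (ger0_norm (mehler_ge0 rho r0 z)).
Qed.

Lemma integrable_hermite_affine k x :
  gam.-integrable [set: M] (fun z => (hermite k (rho * x + r * z))%:E).
Proof.
have := integrable_horner
  ((Num.sqrt k`!%:R)^-1 *: (hermite_poly k \Po (r *: 'X + (rho * x)%:P))).
apply: eq_integrable => // z _ /=; rewrite hermiteE hornerZ horner_comp.
by rewrite hornerD hornerZ hornerX hornerC (addrC (r * z)).
Qed.

Lemma gauss_mean_hermite_affine k x :
  gauss_mean (fun z => hermite k (rho * x + r * z)) = rho ^+ k * hermite k x.
Proof.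
have c0 : Num.sqrt k`!%:R != 0 :> R by rewrite sqrtr_eq0 -ltNge ltr0n fact_gt0.
apply: (mulfI c0); rewrite [in RHS]hermiteE [RHS]mulrCA mulVKf//.
rewrite -(gauss_mean_hermite_poly_affine k x rr1) /gauss_mean -RintegralZl//.
  by apply: eq_Rintegral => z _; rewrite hermiteE mulVKf.
exact: integrable_hermite_affine.
Qed.

(** Integrating out the second variable first replaces its Hermite factor by
    [rho ^+ k * hermite k x]; what remains is [rho ^+ k] times the squared norm of [hermite k],
    which is 1. *)
Lemma dot_mehler_hermite k :
  dot gam2 mehler (tensor (hermite k) (hermite k)) = rho ^+ k.
Proof.
have Lh := sq_integrable_hermite k.
have Lhh := sq_integrable_tensor Lh Lh.
rewrite (dot_mehler Lhh.1) /Rintegral.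
rewrite -(integral12_prod_meas1 (integrable_correlated Lhh)) /fubini_F/= /tensor/=.
transitivity (rho ^+ k * gauss_mean (fun x => hermite k x * hermite k x)); last first.
  by rewrite gauss_mean_hermite_orth eqxx mulr1.
rewrite /gauss_mean -RintegralZl//; last exact: sq_integrable_mul.
congr fine; apply: eq_integral => x _.
under eq_integral do rewrite EFinM.
rewrite integralZl//; last exact: integrable_hermite_affine.
rewrite -[X in (_ * X)%E]fineK; last first.
  by apply: integrable_fin_num => //; exact: integrable_hermite_affine.
by rewrite -EFinM [fine _]gauss_mean_hermite_affine mulrCA.
Qed.

Section hermite_coefficients.
Variable s : M -> R.
Hypothesis Ls : sq_integrable gam s.

Lemma gauss_mean_sqr_dot : gauss_mean (fun x => s x ^+ 2) = dot gam s s.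
Proof. by apply: eq_Rintegral => x _; rewrite expr2. Qed.

Lemma correlated_mean_hermite_bound n :
  (\int[gam2]_z (s z.1 * s (rho * z.1 + r * z.2)) -
   \sum_(k < n) zeta k s ^+ 2 * rho ^+ k) ^+ 2 <=
  (rho ^+ n / r) ^+ 2 * gauss_mean (fun x => s x ^+ 2) ^+ 2.
Proof.
have Lh := sq_integrable_hermite.
have Lss := sq_integrable_tensor Ls Ls.
have := @bessel_remainder _ _ _ gam2
  (fun k => tensor (hermite k) (hermite k)) mehler (fun k => rho ^+ k)
  (fun k => sq_integrable_tensor (Lh k) (Lh k)) sq_integrable_mehler _
  dot_mehler_hermite n _ Lss.
rewrite dot_tensor// -gauss_mean_sqr_dot -expr2 dot_mehler_mehler.
rewrite (dot_mehler Lss.1).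
(* The tail of the geometric series of ratio rho^2 = 1 - r^2, whose full sum is r^-2. *)
have -> : r ^- 2 - \sum_(k < n) (rho ^+ k) ^+ 2 = (rho ^+ n / r) ^+ 2.
  have r2 : r ^+ 2 != 0 by rewrite gt_eqF ?exprn_gt0.
  apply: (mulIf r2); rewrite expr_div_n divfK// mulrBl mulVf//.
  elim: n => [|n IH]; first by rewrite big_ord0 mul0r subr0 expr0 expr1n.
  rewrite big_ord_recr/= mulrDl opprD addrA IH (exprS rho n).
  have -> : r ^+ 2 = 1 - rho ^+ 2 by rewrite -rr1 addrAC subrr add0r.
  ring.
have zE k : dot gam (hermite k) s = zeta k s by rewrite dotC.
under eq_bigr do rewrite dot_tensor// zE -expr2 mulrC.
apply=> j k; rewrite dot_tensor// [dot _ _ _]gauss_mean_hermite_orth.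
by case: eqP => _; rewrite ?mulr1 ?mulr0.
Qed.

End hermite_coefficients.
End fixed_correlation.
End correlation.

(** * Entries of the kernel matrix *)

Section kernel.
Context {R : realType}.
Local Notation M := (measurableTypeR R).
Local Notation gam := (normal_prob (0 : R) (1 : R)).
Local Notation gam2 := (gam \x gam)%E.

(** For unit vectors p^2 = 1 and p >= 0 force p = 1, so q is the inner product. Positive and
    negative parts extend the law to real-valued [F]. *)
Lemma std_gaussian_unit_pair d (a b : 'I_d -> R) :
  \sum_k a k ^+ 2 = 1 -> \sum_k b k ^+ 2 = 1 ->
  exists r, [/\ 0 <= r, (\sum_k a k * b k) ^+ 2 + r ^+ 2 = 1
    & forall F : M * M -> R, measurable_fun [set: M * M] F ->
      \int[std_gaussian d]_w F (\sum_k tnth w k * a k, \sum_k tnth w k * b k) =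
      \int[gam2]_z F (z.1, (\sum_k a k * b k) * z.1 + r * z.2)].
Proof.
move=> a1 b1; have [p [q [r [p0 r0 [pE qE rE] law]]]] := std_gaussian_pair a b.
have p1 : p = 1.
  by apply/eqP; rewrite -sqrp_eq1// pE a1.
move: qE rE law; rewrite p1 mul1r => <- rE law.
exists r; split=> [//||F mF]; first by rewrite rE.
have mF' : measurable_fun [set: M * M] (fun z => (F z)%:E) by exact/measurable_EFinP.
have law1 (G : M * M -> \bar R) : measurable_fun [set: M * M] G ->
    (forall z, 0 <= G z)%E ->
    (\int[std_gaussian d]_w G (\sum_k tnth w k * a k, \sum_k tnth w k * b k)%R =
     \int[gam2]_z G (z.1, q * z.1 + r * z.2)%R)%E.
  by move=> mG G0; rewrite law//; apply: eq_integral => z _; rewrite mul1r.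
congr fine; rewrite integralE [RHS]integralE; congr (_ - _)%E.
- transitivity (\int[std_gaussian d]_w (EFin \o F)^\+
      (\sum_k tnth w k * a k, \sum_k tnth w k * b k)%R)%E.
    by apply: eq_integral => w _; rewrite !funeposE.
  rewrite (law1 _ (measurable_funepos mF') (funepos_ge0 _)).
  by apply: eq_integral => z _; rewrite !funeposE.
- transitivity (\int[std_gaussian d]_w (EFin \o F)^\-
      (\sum_k tnth w k * a k, \sum_k tnth w k * b k)%R)%E.
    by apply: eq_integral => w _; rewrite !funenegE.
  rewrite (law1 _ (measurable_funeneg mF') (funeneg_ge0 _)).
  by apply: eq_integral => z _; rewrite !funenegE.
Qed.

Lemma poly_growth_powR (s : R -> R) (C : R) : 0 <= C ->
  (forall x, `|s x| <= C * (1 + `|x|) `^ C) -> poly_growth s.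
Proof.
move=> C0 sC; exists C, (Num.bound C); split=> // x.
apply: (le_trans (sC x)); rewrite ler_wpM2l// -powR_mulrn ?addr_ge0//.
by rewrite ler_powR ?lerDl// ltW// archi_boundP.
Qed.

Section norms.
Variable s : M -> R.
Hypotheses (ms : measurable_fun [set: M] s) (gs : poly_growth s).

Lemma sq_integrable_poly_growth : sq_integrable gam s.
Proof.
split=> //; apply: integrable_poly_growth; first exact: measurable_funX.
exact: poly_growthX.
Qed.

Lemma norm2_sqr : norm2 s ^+ 2 = gauss_mean (fun x => s x ^+ 2).
Proof. by rewrite sqr_sqrtr//; apply: Rintegral_ge0 => x _; exact: sqr_ge0. Qed.

Lemma norm4_exp4 : norm4 s ^+ 4 = gauss_mean (fun x => s x ^+ 4).
Proof.
have g0 : 0 <= gauss_mean (fun x => s x ^+ 4).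
  by apply: Rintegral_ge0 => x _; rewrite exprn_even_ge0.
by rewrite /norm4 -powR_mulrn ?powR_ge0// -powRrM mulVf ?pnatr_eq0// powRr1.
Qed.

End norms.

(** Cauchy-Schwarz for s^2 against the constant 1, of norm 1 since the measure is a probability. *)
Lemma norm2_le_norm4 (s : M -> R) : measurable_fun [set: M] s -> poly_growth s ->
  norm2 s ^+ 2 <= norm4 s ^+ 2.
Proof.
move=> ms gs; rewrite -(@ler_pXn2r _ 2) ?nnegrE ?sqr_ge0//.
rewrite -[leRHS]exprM norm4_exp4 norm2_sqr.
have L1 : sq_integrable gam (fun=> 1).
  by apply: sq_integrable_poly_growth => //; exact: poly_growth_cst.
have Ls2 : sq_integrable gam (fun x => s x ^+ 2).
  apply: sq_integrable_poly_growth; first exact: measurable_funX.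
  exact: poly_growthX.
have := cauchy_schwarz Ls2 L1.
have -> : dot gam (fun=> 1) (fun=> 1) = 1 :> R.
  by rewrite /dot /Rintegral mulr1 (integral_probability_cst gam).
rewrite mulr1; congr (_ ^+ 2 <= _); apply: eq_Rintegral => x _.
  by rewrite mulr1.
by rewrite -exprD.
Qed.

Section kernel_entries.
Variables (s : M -> R) (d n : nat) (X : 'M[R]_(d, n)).
Hypotheses (ms : measurable_fun [set: M] s) (gs : poly_growth s).
Hypothesis X1 : forall i, l2norm (col i X) = 1.

Let sum_sqr_col i : \sum_k X k i ^+ 2 = 1.
Proof.
have := X1 i; rewrite /l2norm; under eq_bigr do rewrite mxE.
move=> h; rewrite -[LHS]sqr_sqrtr ?h ?expr1n//.
by apply: sumr_ge0 => k _; exact: sqr_ge0.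
Qed.

Lemma gramE i j : gram X i j = \sum_k X k i * X k j.
Proof. by rewrite mxE; apply: eq_bigr => k _; rewrite mxE. Qed.

Lemma gram_diag i : gram X i i = 1.
Proof. by rewrite gramE -(sum_sqr_col i); apply: eq_bigr => k _; rewrite expr2. Qed.

Lemma kernel_mx_pair i j : exists r, [/\ 0 <= r, gram X i j ^+ 2 + r ^+ 2 = 1
  & kernel_mx s X i j = \int[gam2]_z (s z.1 * s (gram X i j * z.1 + r * z.2))].
Proof.
have [r [r0 rE law]] := std_gaussian_unit_pair (sum_sqr_col i) (sum_sqr_col j).
exists r; rewrite gramE; split=> //; rewrite mxE.
have mss : measurable_fun [set: M * M] (tensor s s).
  by apply: measurable_funM; apply: measurableT_comp.
by have := law _ mss.
Qed.

(** Correlation 1 forces r = 0, where [mehler] is no density; the pair is then (z1, z1), and z2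
    integrates out. *)
Lemma kernel_mx_diag i : kernel_mx s X i i = norm2 s ^+ 2.
Proof.
have [r [r0 rE ->]] := kernel_mx_pair i i.
have r00 : r = 0.
  move: rE; rewrite gram_diag expr1n => /(canRL (addKr _)).
  by rewrite addNr => /eqP; rewrite sqrf_eq0 => /eqP.
rewrite gram_diag r00 norm2_sqr.
have Ls := sq_integrable_poly_growth ms gs.
have L1 : gam.-integrable [set: M] (EFin \o cst (1 : R)).
  by apply: integrable_poly_growth => //; exact: poly_growth_cst.
have := Rintegral_prod_mul Ls.2 L1.
rewrite [X in _ * X](_ : _ = 1) ?mulr1.
  by move=> <-; apply: eq_Rintegral => z _; rewrite mul1r mul0r addr0 mulr1 expr2.
rewrite (_ : cst 1 = horner 1%:P) ?gauss_mean_hornerC//.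
by apply/funext => x; rewrite hornerC.
Qed.

(** Here [l] counts the terms kept, one more than the truncation degree. *)
Lemma kernel_mx_offdiag_bound l i j : `|gram X i j| <= 1 / Num.sqrt 2 ->
  `|\sum_(k < l) zeta k s ^+ 2 * gram X i j ^+ k - kernel_mx s X i j| <=
  Num.sqrt 2 * norm4 s ^+ 2 * `|gram X i j ^+ l|.
Proof.
move=> rho_le; have [r [r_ge0 rE ->]] := kernel_mx_pair i j.
have sq20 : 0 < Num.sqrt 2 :> R by rewrite sqrtr_gt0.
have sq2 : Num.sqrt 2 ^+ 2 = 2 :> R by rewrite sqr_sqrtr.
have rho2 : gram X i j ^+ 2 <= 2^-1.
  rewrite -(real_normK (num_real (gram X i j))).
  have := lerXn2r 2 (normr_ge0 _) _ rho_le.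
  rewrite nnegrE => /(_ (divr_ge0 ler01 (ltW sq20))).
  by rewrite div1r exprVn sq2.
(* The source of the factor sqrt 2: the remainder carries 1/r, and r^2 = 1 - rho^2 is at least 1/2
   by the coherence bound. *)
have r2 : 2^-1 <= r ^+ 2 by lra.
have r0 : 0 < r.
  rewrite lt_neqAle r_ge0 andbT; apply: contraTneq r2 => <-.
  by rewrite expr0n -ltNge invr_gt0.
have Ls := sq_integrable_poly_growth ms gs.
have := correlated_mean_hermite_bound r0 rE Ls l.
rewrite -norm2_sqr -sqrrN opprB => bound.
rewrite -(@ler_pXn2r _ 2) ?nnegrE ?mulr_ge0 ?normr_ge0 ?sqr_ge0 ?powR_ge0 ?(ltW sq20)//.
rewrite real_normK ?num_real//; apply: (le_trans bound).
set t := gram X i j ^+ l.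
have N : (norm2 s ^+ 2) ^+ 2 <= (norm4 s ^+ 2) ^+ 2.
  by rewrite ler_pXn2r ?nnegrE ?sqr_ge0//; exact: norm2_le_norm4.
have ri : (r ^+ 2)^-1 <= 2 by rewrite -[leRHS]invrK lef_pV2// posrE ?exprn_gt0.
rewrite (_ : (_ * `|t|) ^+ 2 = t ^+ 2 * 2 * (norm4 s ^+ 2) ^+ 2); last first.
  by rewrite !exprMn sq2 real_normK ?num_real//; ring.
rewrite expr_div_n; apply: ler_pM => //.
- by rewrite mulr_ge0 ?sqr_ge0// invr_ge0 sqr_ge0.
- exact: sqr_ge0.
by apply: ler_wpM2l ri; exact: sqr_ge0.
Qed.

End kernel_entries.
End kernel.

(** * Norms, quadratic forms and eigenvalues *)

Section symmetric_eigenvalue.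
Import complex.

(** For an eigenvector v, [lam] times the nonzero real number v v^* is v B v^*, which is its own
    conjugate. *)
Lemma symmetric_eigenvalue_real (C : numClosedFieldType) n (B : 'M[C]_n) lam :
  (forall i j, (B i j)^* = B i j) -> B^T = B -> eigenvalue B lam -> lam^* = lam.
Proof.
move=> Bc Bs /eigenvalueP[v vB v0].
pose q := \sum_i v 0 i * (v 0 i)^*.
have q0 : q != 0.
  apply: contraNneq v0 => q0; apply/eqP/rowP => i; rewrite mxE.
  have := psumr_eq0P (fun i _ => mul_conjC_ge0 (v 0 i)) q0.
  by move=> /(_ i isT)/eqP; rewrite mul_conjC_eq0 => /eqP.
have qE : lam * q = \sum_i \sum_j v 0 i * B i j * (v 0 j)^*.
  rewrite exchange_big mulr_sumr; apply: eq_bigr => j _.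
  rewrite -mulr_suml mulrA; congr (_ * _).
  by have /rowP/(_ j) := vB; rewrite !mxE => <-.
have qc : q^* = q.
  by rewrite rmorph_sum; apply: eq_bigr => i _; rewrite rmorphM /= conjCK mulrC.
apply: (mulIf q0); rewrite -{1}qc -rmorphM qE rmorph_sum exchange_big.
apply: eq_bigr => i _; rewrite rmorph_sum; apply: eq_bigr => j _.
have -> : B i j = B j i by rewrite -[in LHS]Bs mxE.
by rewrite !rmorphM /= conjCK Bc; ring.
Qed.

(** A complex root of the characteristic polynomial exists and is real. This makes the set whose
    infimum is [lambda_min] nonempty, without which a lower bound on its elements would say nothing
    about the infimum. *)
Lemma symmetric_has_eigenvalue (R : rcfType) n (A : 'M[R]_n.+1) :
  A^T = A -> exists a, eigenvalue A a.
Proof.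
move=> symA; pose f : {rmorphism R -> complex R} := real_complex R.
pose B : 'M[complex R]_n.+1 := map_mx f A.
have [lam lam_root] : exists lam : complex R, root (char_poly B) lam.
  by apply/closed_rootP; rewrite size_char_poly.
have : lam^* = lam.
  apply: (@symmetric_eigenvalue_real _ _ B); last by rewrite eigenvalue_root_char.
    by move=> i j; rewrite !mxE; apply/eqP; rewrite eq_complex /= oppr0 !eqxx.
  by rewrite /B map_trmx symA.
case: lam lam_root => a b ab_root /eqP; rewrite eq_complex /= eqxx/= => /eqP bN.
have b0 : b = 0 by lra.
exists a; rewrite eigenvalue_root_char -(fmorph_root f).
by move: ab_root; rewrite b0 -map_char_poly.
Qed.

End symmetric_eigenvalue.

Section norms.
Context {R : realType}.

(** As in Lagrange's identity, (a_i b_j - a_j b_i)^2 >= 0 is summed over all pairs. *)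
Lemma sum_cauchy_schwarz (I : finType) (a b : I -> R) :
  (\sum_i a i * b i) ^+ 2 <= (\sum_i a i ^+ 2) * (\sum_i b i ^+ 2).
Proof.
have le i j : 2 * ((a i * b i) * (a j * b j)) <=
    a i ^+ 2 * b j ^+ 2 + a j ^+ 2 * b i ^+ 2.
  by have := sqr_ge0 (a i * b j - a j * b i); nra.
rewrite -(@ler_pM2l _ 2)// expr2 !big_distrlr/= mulr_sumr.
under [leLHS]eq_bigr do rewrite mulr_sumr.
apply: (le_trans (ler_sum _ (fun i _ => ler_sum _ (fun j _ => le i j)))).
under [leLHS]eq_bigr do rewrite big_split/=.
by rewrite big_split/= [X in _ + X]exchange_big/= -mulr2n mulr_natl.
Qed.

Lemma l2norm_ge0 n (v : 'cV[R]_n) : 0 <= l2norm v.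
Proof. exact: sqrtr_ge0. Qed.

Lemma frobenius_norm_ge0 m n (A : 'M[R]_(m, n)) : 0 <= frobenius_norm A.
Proof. exact: sqrtr_ge0. Qed.

Lemma frobenius_norm_sqr m n (A : 'M[R]_(m, n)) :
  frobenius_norm A ^+ 2 = \sum_i \sum_j A i j ^+ 2.
Proof.
rewrite sqr_sqrtr//; apply: sumr_ge0 => i _; apply: sumr_ge0 => j _.
exact: sqr_ge0.
Qed.

Lemma l2norm_sqr n (v : 'cV[R]_n) : l2norm v ^+ 2 = \sum_i v i 0 ^+ 2.
Proof. by rewrite sqr_sqrtr//; apply: sumr_ge0 => i _; exact: sqr_ge0. Qed.

Lemma l2norm_mulmx_le m n (A : 'M[R]_(m, n)) v :
  l2norm (A *m v) <= frobenius_norm A * l2norm v.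
Proof.
rewrite -(@ler_pXn2r _ 2) ?nnegrE ?mulr_ge0 ?l2norm_ge0 ?frobenius_norm_ge0//.
rewrite exprMn !l2norm_sqr frobenius_norm_sqr mulr_suml; apply: ler_sum => i _.
by rewrite mxE; exact: sum_cauchy_schwarz.
Qed.

Lemma spectral_norm_le_frobenius m n (A : 'M[R]_(m, n)) :
  spectral_norm A <= frobenius_norm A.
Proof.
apply: ge_sup.
  exists (l2norm (A *m 0)); exists 0 => //=.
  by rewrite /l2norm big1 ?sqrtr0// => i _; rewrite mxE expr0n.
move=> _ [v /= v1 <-]; apply: (le_trans (l2norm_mulmx_le A v)).
by rewrite ler_piMr// frobenius_norm_ge0.
Qed.

Lemma frobenius_norm_le_scale m n (A B : 'M[R]_(m, n)) c : 0 <= c ->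
  (forall i j, `|A i j| <= c * `|B i j|) -> frobenius_norm A <= c * frobenius_norm B.
Proof.
move=> c0 AB.
rewrite -(@ler_pXn2r _ 2) ?nnegrE ?mulr_ge0 ?frobenius_norm_ge0//.
rewrite exprMn !frobenius_norm_sqr mulr_sumr; apply: ler_sum => i _.
rewrite mulr_sumr; apply: ler_sum => j _.
rewrite -(real_normK (num_real (A i j))) -(real_normK (num_real (B i j))) -exprMn.
by rewrite lerXn2r ?nnegrE ?mulr_ge0.
Qed.

Lemma entry_le_frobenius_norm m n (A : 'M[R]_(m, n)) i j :
  `|A i j| <= frobenius_norm A.
Proof.
rewrite -(@ler_pXn2r _ 2) ?nnegrE ?frobenius_norm_ge0// real_normK ?num_real//.
rewrite frobenius_norm_sqr (bigD1 i)//= (bigD1 j)//= -addrA lerDl addr_ge0//.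
  by apply: sumr_ge0 => k _; exact: sqr_ge0.
by apply: sumr_ge0 => k _; apply: sumr_ge0 => k' _; exact: sqr_ge0.
Qed.

(** Taking a function instead of a vector lets weights be modified pointwise and a row eigenvector
    be passed as [v 0]. *)
Definition quad n (A : 'M[R]_n) (v : 'I_n -> R) := \sum_i \sum_j v i * v j * A i j.

Lemma quadD n (A B : 'M[R]_n) v : quad (A + B) v = quad A v + quad B v.
Proof.
rewrite /quad -big_split; apply: eq_bigr => i _; rewrite -big_split.
by apply: eq_bigr => j _; rewrite mxE mulrDr.
Qed.

Lemma quadZ n c (A : 'M[R]_n) v : quad (c *: A) v = c * quad A v.
Proof.
rewrite /quad mulr_sumr; apply: eq_bigr => i _; rewrite mulr_sumr.
by apply: eq_bigr => j _; rewrite mxE mulrCA.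
Qed.

Lemma quad_scalar n c v : quad (c%:M : 'M[R]_n) v = c * \sum_i v i ^+ 2.
Proof.
rewrite /quad mulr_sumr; apply: eq_bigr => i _.
rewrite (bigD1 i)//= big1 ?addr0 => [|j ji]; rewrite mxE.
  by rewrite eqxx mulr1n mulrC expr2.
by rewrite eq_sym (negbTE ji) mulr0.
Qed.

(** Cauchy-Schwarz over pairs (i, j): the squares of the weights v_i v_j sum to the square of sum
    v_i^2. *)
Lemma quad_le_frobenius n (A : 'M[R]_n) v :
  `|quad A v| <= frobenius_norm A * \sum_i v i ^+ 2.
Proof.
have S0 : 0 <= \sum_i v i ^+ 2 by apply: sumr_ge0 => i _; exact: sqr_ge0.
rewrite -(@ler_pXn2r _ 2) ?nnegrE ?mulr_ge0 ?frobenius_norm_ge0//.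
rewrite real_normK ?num_real// exprMn frobenius_norm_sqr /quad !pair_big/=.
apply: (le_trans (sum_cauchy_schwarz (fun p => v p.1 * v p.2) (fun p => A p.1 p.2))).
rewrite mulrC; apply: ler_wpM2l.
  by apply: sumr_ge0 => p _; exact: sqr_ge0.
rewrite expr2 big_distrlr/= pair_big/=.
by under eq_bigr do rewrite exprMn.
Qed.

(* Schur product theorem, for powers of a Gram matrix: each factor of
   [gram X] is absorbed into the weights. *)
Lemma quad_hadamard_gram_ge0 d n (X : 'M[R]_(d, n)) k v :
  0 <= quad (hadamard_pow k (gram X)) v.
Proof.
elim: k v => [|k IH] v.
  rewrite (_ : quad _ _ = (\sum_i v i) ^+ 2) ?sqr_ge0//.
  rewrite expr2 big_distrlr/=; apply: eq_bigr => i _; apply: eq_bigr => j _.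
  by rewrite mxE expr0 mulr1.
rewrite (_ : quad _ _ =
    \sum_m quad (hadamard_pow k (gram X)) (fun i => v i * X m i)).
  by apply: sumr_ge0.
rewrite /quad [RHS]exchange_big/=; apply: eq_bigr => i _.
rewrite [RHS]exchange_big/=; apply: eq_bigr => j _.
rewrite mxE exprS [in LHS]mxE mulr_suml mulr_sumr; apply: eq_bigr => m _.
by rewrite !mxE; ring.
Qed.

(** On an eigenvector the quadratic form is the eigenvalue times the squared norm; symmetry and
    [0 < n] provide an eigenvalue, so that the infimum is a genuine one. *)
Lemma lambda_min_ge n (A : 'M[R]_n) c : (0 < n)%N -> A^T = A ->
  (forall v, c * \sum_i v i ^+ 2 <= quad A v) -> c <= lambda_min A.
Proof.
case: n A => // n A _ symA Ac; apply: lb_le_inf.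
  by have [a aA] := symmetric_has_eigenvalue symA; exists a.
move=> a /= /eigenvalueP[v vA v0].
have S0 : 0 < \sum_i v 0 i ^+ 2.
  rewrite lt_neqAle eq_sym sumr_ge0 ?andbT => [|i _]; last exact: sqr_ge0.
  apply: contraNneq v0 => /psumr_eq0P S0; apply/eqP/rowP => i; rewrite mxE.
  by have /eqP := S0 (fun i _ => sqr_ge0 _) i isT; rewrite sqrf_eq0 => /eqP.
have := Ac (v 0); rewrite (_ : quad _ _ = a * \sum_i v 0 i ^+ 2).
  by rewrite ler_pM2r.
rewrite /quad exchange_big mulr_sumr; apply: eq_bigr => j _.
have /rowP/(_ j) := vA; rewrite !mxE => vAj.
rewrite expr2 mulrA -vAj mulr_suml; apply: eq_bigr => i _.
by ring.
Qed.

End norms.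

(** * Bounds on the kernel matrix *)

Section assembly.
Context {R : realType}.
Local Notation M := (measurableTypeR R).

Lemma kernel_mx_sym (s : R -> R) d n (X : 'M[R]_(d, n)) :
  (kernel_mx s X)^T = kernel_mx s X.
Proof.
by apply/matrixP => i j; rewrite !mxE; apply: eq_Rintegral => w _; exact: mulrC.
Qed.

Lemma kernel_trunc_mxE l (s : R -> R) d n (X : 'M[R]_(d, n)) i j :
  kernel_trunc_mx l s X i j =
  \sum_(k < l.+1) zeta k s ^+ 2 * gram X i j ^+ k + sigma_gt2 l s *+ (i == j).
Proof.
rewrite mxE summxE [X in _ + X]mxE; congr (_ + _); apply: eq_bigr => k _.
by rewrite !mxE.
Qed.

Lemma quad_kernel_trunc_mx_ge l (s : R -> R) d n (X : 'M[R]_(d, n)) v :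
  sigma_gt2 l s * \sum_i v i ^+ 2 <= quad (kernel_trunc_mx l s X) v.
Proof.
rewrite quadD quad_scalar lerDr.
apply: (big_ind (fun A => 0 <= quad A v)) => [|A B A0 B0|k _].
- by rewrite -(scale0r (0 : 'M[R]_n)) quadZ mul0r.
- by rewrite quadD addr_ge0.
- by rewrite quadZ mulr_ge0 ?sqr_ge0// quad_hadamard_gram_ge0.
Qed.

Lemma le_max_offdiag n (A : 'M[R]_n) i j : i != j -> `|A i j| <= max_offdiag A.
Proof.
move=> ij; exact: (@le_bigmax_cond _ _ _ 0 (i, j) (fun p : 'I_n * 'I_n => p.1 != p.2)
  (fun p => `|A p.1 p.2|)).
Qed.

(** The condition [0 <= c] accounts for the default 0 of the maximum. *)
Lemma max_offdiag_le n (A : 'M[R]_n) c : 0 <= c ->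
  (forall i j, i != j -> `|A i j| <= c) -> max_offdiag A <= c.
Proof. by move=> c0 Ac; apply: bigmax_le => // -[i j] /= ij; exact: Ac. Qed.

Section fixed_data.
Variables (s : M -> R) (d n : nat) (X : 'M[R]_(d, n)) (l : nat).
Hypotheses (ms : measurable_fun [set: M] s) (gs : poly_growth s).
Hypothesis X1 : forall i, l2norm (col i X) = 1.

Lemma gram_pow_error_offdiag i j : i != j ->
  (hadamard_pow l.+1 (gram X) - 1%:M) i j = gram X i j ^+ l.+1.
Proof. by move=> /negbTE ij; rewrite !mxE ij subr0. Qed.

(** This lets the convergence of the error also enforce the bound on [max_offdiag]. *)
Lemma gram_le_error i j : i != j -> `|gram X i j| ^+ l.+1 <= gram_pow_error l X.
Proof.
move=> ij; rewrite -normrX -(gram_pow_error_offdiag ij).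
exact: entry_le_frobenius_norm.
Qed.

Lemma frobenius_kernel_error : max_offdiag (gram X) <= 1 / Num.sqrt 2 ->
  frobenius_norm (kernel_trunc_mx l s X - kernel_mx s X) <=
  Num.sqrt 2 * norm4 s ^+ 2 * gram_pow_error l X.
Proof.
move=> X2; apply: frobenius_norm_le_scale => [|i j].
  by rewrite mulr_ge0 ?sqr_ge0 ?sqrtr_ge0.
rewrite [(_ - kernel_mx s X) i j]mxE kernel_trunc_mxE [(- _ : 'M[R]_n) i j]mxE.
have [<-|ij] := eqVneq i j.
  (* On the diagonal all powers of the Gram entry are 1, and adding [sigma_gt2] to the sum of the
     [zeta k s ^+ 2] restores [norm2 s ^+ 2]: the difference is exactly 0. *)
  rewrite (kernel_mx_diag ms gs X1) (gram_diag X1) /sigma_gt2.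
  under eq_bigr do rewrite expr1n mulr1.
  rewrite mulr1n [X in X - _]addrC subrK subrr normr0.
  by apply: mulr_ge0 => //; rewrite mulr_ge0 ?sqr_ge0 ?sqrtr_ge0.
rewrite gram_pow_error_offdiag// mulr0n addr0.
apply: (kernel_mx_offdiag_bound ms gs X1 l.+1).
by apply: le_trans X2; exact: le_max_offdiag.
Qed.

End fixed_data.
End assembly.

Theorem proposition2p4 (R : realType) (sigma : R -> R) (Csigma : R)
    (d : nat -> nat) (X : forall n, 'M[R]_(d n, n)) (l : nat)
    (sigma_meas : measurable_fun [set: R] sigma)
    (Csigma_ge0 : 0 <= Csigma)
    (sigma_growth : forall x, `|sigma x| <= Csigma * (1 + `|x|) `^ Csigma)
    (d_grows : d n @[n --> \oo] --> \oo)
    (X_unit : forall n (i : 'I_n), l2norm (col i (X n)) = 1)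
    (l_smallest : is_smallest
       (fun m => gram_pow_error m (X n) @[n --> \oo] --> (0 : R)) l)
    (sigma_gt2_gt0 : 0 < sigma_gt2 l sigma) :
  exists n0 : nat,
    is_smallest (fun m => forall n, (m <= n)%N ->
        max_offdiag (gram (X n)) <= 1 / Num.sqrt 2 /\
        gram_pow_error l (X n) <= sigma_gt2 l sigma / (4 * norm4 sigma ^+ 2))
      n0 /\
    forall n, (n0 <= n)%N -> (0 < n)%N ->
      lambda_min (kernel_mx sigma (X n)) >= 1 / 2 * sigma_gt2 l sigma /\
      spectral_norm (kernel_trunc_mx l sigma (X n) - kernel_mx sigma (X n))
        <= Num.sqrt 2 * norm4 sigma ^+ 2 * gram_pow_error l (X n) /\
      Num.sqrt 2 * norm4 sigma ^+ 2 * gram_pow_error l (X n)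
        <= sigma_gt2 l sigma / (2 * Num.sqrt 2).
Proof.
have gs := poly_growth_powR Csigma_ge0 sigma_growth.
set P := (P in is_smallest P).
have r2_gt0 : 0 < Num.sqrt 2 :> R by rewrite sqrtr_gt0.
have r2_sqr : Num.sqrt 2 ^+ 2 = 2 :> R by rewrite sqr_sqrtr.
(* Positivity of sigma_{>l}^2 excludes a vanishing activation, since sigma_{>l}^2 <= ||sigma||_2^2
   <= ||sigma||_4^2; the threshold on the error is therefore positive. *)
have N0 : 0 < norm4 sigma ^+ 2.
  apply: (lt_le_trans sigma_gt2_gt0); apply: le_trans (norm2_le_norm4 sigma_meas gs).
  by rewrite /sigma_gt2 gerDl oppr_le0 sumr_ge0// => k _; exact: sqr_ge0.
have [m Pm] : exists m, P m.
  case: l_smallest => cvgE _.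
  have e1 : 0 < sigma_gt2 l sigma / (4 * norm4 sigma ^+ 2).
    by rewrite divr_gt0// mulr_gt0.
  (* The error dominates [|rho| ^+ l.+1], so the threshold on [|rho|] is raised to that power. *)
  have e2 : 0 < (1 / Num.sqrt 2) ^+ l.+1 :> R by rewrite exprn_gt0// divr_gt0.
  have [m1 _ Hm1] := cvgr_lt _ cvgE _ e1.
  have [m2 _ Hm2] := cvgr_lt _ cvgE _ e2.
  exists (maxn m1 m2) => n; rewrite geq_max => /andP[/Hm1 n1 /Hm2 n2].
  split; last exact: ltW.
  apply: max_offdiag_le => [|i j ij]; first by rewrite divr_ge0// ltW.
  rewrite -(@ler_pXn2r _ l.+1) ?nnegrE ?divr_ge0 ?(ltW r2_gt0)//.
  exact: le_trans (gram_le_error _ _ ij) (ltW n2).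
have exP : exists m, `[< P m >] by exists m; exact/asboolP.
case: (ex_minnP exP) => n0 /asboolP Pn0 n0_min; exists n0; split.
  by split=> // k Pk; exact/n0_min/asboolP.
move=> n n0n n_gt0; have [X2 EX] := Pn0 n n0n.
have frob := frobenius_kernel_error l sigma_meas gs (X_unit n) X2.
have EG : Num.sqrt 2 * norm4 sigma ^+ 2 * gram_pow_error l (X n) <=
    sigma_gt2 l sigma / (2 * Num.sqrt 2).
  have c0 : 0 <= Num.sqrt 2 * norm4 sigma ^+ 2 by rewrite mulr_ge0 ?sqr_ge0 ?ltW.
  apply: (le_trans (ler_wpM2l c0 EX)).
  have E (t u g : R) : t ^+ 2 = 2 -> t != 0 -> u != 0 ->
    t * u * (g / (4 * u)) = g / (2 * t) by move=> t2 t0 u0; field: t2; apply/andP.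
  by rewrite E// gt_eqF.
split; last by split=> //; exact: le_trans (spectral_norm_le_frobenius _) frob.
apply: lambda_min_ge => // [|v]; first exact: kernel_mx_sym.
set K := kernel_mx sigma (X n); set T := kernel_trunc_mx l sigma (X n).
have S0 : 0 <= \sum_i v i ^+ 2 by apply: sumr_ge0 => i _; exact: sqr_ge0.
have KE : K = T + (-1) *: (T - K) by rewrite scaleN1r opprB addrC subrK.
(* As sqrt 2 >= 1, the bound sigma_{>l}^2 / (2 sqrt 2) is at most half of sigma_{>l}^2; the other
   half remains as the lower bound on [quad K]. *)
have half : frobenius_norm (T - K) <= sigma_gt2 l sigma / 2.
  apply: (le_trans frob); apply: (le_trans EG).
  rewrite ler_wpM2l ?(ltW sigma_gt2_gt0)// lef_pV2 ?posrE ?mulr_gt0// ler_peMr//.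
  by rewrite -(@ler_pXn2r _ 2) ?nnegrE ?(ltW r2_gt0)// r2_sqr expr1n ler1n.
have D : quad (T - K) v <= sigma_gt2 l sigma / 2 * \sum_i v i ^+ 2.
  apply: le_trans (ler_norm _) (le_trans (quad_le_frobenius _ _) _).
  exact: ler_wpM2r half.
have := quad_kernel_trunc_mx_ge l sigma (X n) v; rewrite -/T => Tv.
rewrite KE quadD quadZ; lra.
Qed.
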